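(* Let $(X,\mathcal{X})$ and $(Y,\mathcal{Y})$ be measurable spaces in which all singletons are measurable, let $\mathbb{Q}$ be a probability measure on the configuration space $(\mathfrak{C}(X),\mathfrak{F}_X)$, let $\mu$ be a probability measure on $(Y,\mathcal{Y})$, and let $(Y,\mathcal{Y},\mu,\mathbf{d},\gamma)$ be a local Dirichlet structure with carré du champ operator $\gamma$ such that $1\in\mathbf{d}_{loc}$ (hence $\gamma[1]=0$). Let $M$ be the random measure on $X$ with law $\mathbb{Q}$, let $N=M\odot\mu$ be the random measure $M$ marked by $\mu$, with law $\mathbb{P}$ on $(\mathfrak{C}(X\times Y),\mathfrak{F}_{X\times Y})$, and let $(\mathfrak{C}(X\times Y),\mathfrak{F}_{X\times Y},\mathbb{P},\mathbb{D},\Gamma)$ be the associated upper Dirichlet structure. Then: (1) for every $F\in\mathbb{D}$, $$\Gamma[F]=\int \varepsilon^-\gamma[\varepsilon^+F]\,dN ;$$ (2) if for every $n\in\mathbb{N}$ the finite product structure $(Y,\mathcal{Y},\mu,\mathbf{d},\gamma)^n$ satisfies the Energy Image Density property (EID), then $(\mathfrak{C}(X\times Y),\mathfrak{F}_{X\times Y},\mathbb{P},\mathbb{D},\Gamma)$ satisfies (EID).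
   Context: Configuration space: $\mathfrak{C}(X)$ is the set of countable sums $m$ of Dirac masses on $X$ with $m\{x\}\in\{0,1\}$ for all $x\in X$; $m$ is identified with its (countable) support. It carries the smallest $\sigma$-field $\mathfrak{F}_X$ making $\omega\mapsto \mathrm{card}(\omega\cap A)$ measurable for every $A\in\mathcal{X}$. The space $(\mathfrak{C}(X\times Y),\mathfrak{F}_{X\times Y})$ is defined in the same way from $X\times Y$; its current point is denoted $\varpi$. Marked random measure: for $F$ bounded and $\mathfrak{F}_{X\times Y}$-measurable and a configuration $\{x_1,x_2,\ldots\}\in\mathfrak{C}(X)$, put $$S(F)=\int F((x_1,y_1),\ldots,(x_n,y_n),\ldots)\,\mu(dy_1)\cdots\mu(dy_n)\cdots,$$ which does not depend on the numbering of the points and is $\mathfrak{F}_X$-measurable. The probability measure $\mathbb{P}$ on $(\mathfrak{C}(X\times Y),\mathfrak{F}_{X\times Y})$ is defined by $\mathbb{P}(F)=\int S(F)\,d\mathbb{Q}$. The random measure with law $\mathbb{P}$ is denoted $N=M\odot\mu$; thus, at the point $\varpi=\{(x_i,u_i)\}_i$, $N=\sum_i\varepsilon_{(x_i,u_i)}$, where $\varepsilon_z$ is the Dirac mass at $z$. Dirichlet structures: $\mathbf{d}\subset L^2(\mu)$ is the domain of the Dirichlet form, $\gamma$ its carré du champ operator, $\gamma[f]=\gamma[f,f]$. The local domain $\mathbf{d}_{loc}$ is the set of measurable functions $f$ for which there are measurable sets $\Omega_n$ with union $Y$ and $f_n\in\mathbf{d}$ with $f=f_n$ on $\Omega_n$.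 The product structure $(Y,\mathcal{Y},\mu,\mathbf{d},\gamma)^n$ lives on $(Y^n,\mathcal{Y}^{\otimes n},\mu^{\otimes n})$; its domain is the set of $f\in L^2(\mu^{\otimes n})$ such that for each $i$ and a.e. value of the other coordinates, $f$ as a function of the $i$-th coordinate is in $\mathbf{d}$, and $\int\sum_i\gamma_i[f]\,d\mu^{\otimes n}<\infty$ ($\gamma_i$ being $\gamma$ acting on the $i$-th coordinate); its carré du champ is $\sum_{i=1}^n\gamma_i[f]$. Upper Dirichlet structure: $\mathbb{D}$ is the set of $F\in L^2(\mathbb{P})$ such that for $\mathbb{Q}$-a.e. $m=\sum_i\varepsilon_{x_i}$, for all $i$, for $\mu$-a.e. $u_1,\ldots,$ $\mu$-a.e. $u_{i-1}$, $\mu$-a.e. $u_{i+1},\ldots$, the function $$F((x_1,u_1),\ldots,(x_{i-1},u_{i-1}),(x_i,\,\cdot\,),(x_{i+1},u_{i+1}),\ldots)$$ belongs to $\mathbf{d}$, and $\mathbb{E}_{\mathbb{P}}\big[\sum_i\gamma_i[F]\big]<+\infty$, where $\gamma_i[F]$ denotes $\gamma$ applied to the function $u\mapsto F((x_1,u_1),\ldots,(x_{i-1},u_{i-1}),(x_i,u),(x_{i+1},u_{i+1}),\ldots)$ of the mark of $x_i$, evaluated at $u=u_i$. The operator is $\Gamma[F]=\sum_i\gamma_i[F]$. This defines a local Dirichlet structure with carré du champ $(\mathfrak{C}(X\times Y),\mathfrak{F}_{X\times Y},\mathbb{P},\mathbb{D},\Gamma)$. Operators $\varepsilon^\pm$: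 $\varepsilon^+_{(x,u)}\varpi=\varpi\cup\{(x,u)\}$ and $\varepsilon^-_{(x,u)}\varpi=\varpi\cap\{(x,u)\}^c$. For $F$ a function of $\varpi$, $(\varepsilon^+F)(\varpi,x,u)=F(\varepsilon^+_{(x,u)}\varpi)$; for $G$ a function of $(\varpi,x,u)$, $(\varepsilon^-G)(\varpi,x,u)=G(\varepsilon^-_{(x,u)}\varpi,x,u)$. In $\gamma[\varepsilon^+F]$, $\gamma$ acts on the variable $u$ only, with $\varpi$ and $x$ fixed, the result being evaluated at $u$. The integral $\int G\,dN$ at $\varpi$ is $\sum_{(x,u)\in\varpi}G(\varpi,x,u)$. (EID): a Dirichlet form on $L^2(\nu)$ ($\nu$ $\sigma$-finite) with carré du champ $\gamma$ satisfies (EID) if for every $d\ge 1$ and every $\mathbb{R}^d$-valued $U=(U_1,\ldots,U_d)$ with components in the domain of the form, $$U_*\big[(\det\gamma[U,U^t])\cdot\nu\big]\ll\lambda^d,$$ where $\gamma[U,U^t]$ is the matrix $(\gamma[U_i,U_j])_{i,j}$, $U_*$ denotes image measure by $U$, and $\lambda^d$ is Lebesgue measure on $\mathbb{R}^d$. *)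

(* Defs.v *)
From HB Require Import structures.
From mathcomp Require Import all_boot all_order all_algebra.
From mathcomp Require Import all_classical all_reals all_analysis.
From mathcomp Require Import measurable_realfun.

Set Implicit Arguments.
Unset Strict Implicit.
Unset Printing Implicit Defensive.
Import Order.TTheory GRing.Theory Num.Theory.
Import numFieldNormedType.Exports.

Local Open Scope classical_set_scope.
Local Open Scope ring_scope.

(** * Configurations *)

(** A countable sum of Dirac masses giving mass 0 or 1 to every point is
    identified with its support. *)
Record config (T : Type) := Config {
  points :> set T;
  countable_points : countable points }.

HB.instance Definition _ (T : Type) := gen_eqMixin (config T).
HB.instance Definition _ (T : Type) := gen_choiceMixin (config T).
HB.instance Definition _ (T : Type) :=
  isPointed.Build (config T) (Config (@countable0 T)).

Definition config_display : measure_display -> measure_display.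
Proof. exact. Qed.

Section config_measurable.
Context d (T : measurableType d).

(** The cardinal of w `&` A lies in {0, 1, ..., oo}: it is a measurable function
    of w iff the events {card (w `&` A) = k}, k finite, are measurable. *)
Definition config_gen : set (set (config T)) :=
  [set B | exists (A : set T) (k : nat),
    measurable A /\ B = [set w : config T | ((w `&` A) #= `I_k)%card]].

HB.instance Definition _ := @isMeasurable.Build (config_display d)
  (config T) <<s config_gen >> (@sigma_algebra0 _ setT config_gen)
  (@sigma_algebraC _ config_gen) (@sigma_algebra_bigcup _ setT config_gen).

End config_measurable.

Lemma countable_eps_plus (T : Type) (w : config T) (z : T) :
  countable (w `|` [set z]).
Proof.
rewrite -bigcup2E; apply: bigcup_countable => // -[|[|i]] _ /=.
- exact: countable_points.
- exact: countable1.
- exact: countable0.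
Qed.

Lemma countable_eps_minus (T : Type) (w : config T) (z : T) :
  countable (w `&` ~` [set z]).
Proof.
exact: sub_countable (subset_card_le (@subIsetl _ _ _)) (countable_points w).
Qed.

Definition eps_plus (T : Type) (w : config T) (z : T) : config T :=
  Config (countable_eps_plus w z).

Definition eps_minus (T : Type) (w : config T) (z : T) : config T :=
  Config (countable_eps_minus w z).

(** [numbering w] is injective on the points of [w]: it provides the numbering
    x_1, x_2, ... of a configuration. *)
Definition numbering (T : Type) (w : config T) : T -> nat :=
  sval (cid (elimT (@countable_injP T w) (countable_points w))).

(** * Product measures *)

Section finite_product.
Context d (T : measurableType d) (R : realType).

Definition tcons n (p : n.-tuple T * T) : n.+1.-tuple T := [tuple of p.2 :: p.1].

Lemma measurable_tcons n : measurable_fun setT (@tcons n).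
Proof. exact: (measurable_cons measurable_snd measurable_fst). Qed.

HB.instance Definition _ n :=
  isMeasurableFun.Build _ _ _ _ (@tcons n) (@measurable_tcons n).

Section mpowerS.
Variables (mu : {sigma_finite_measure set T -> \bar R}) (n : nat).
Variable nu : {measure set (n.-tuple T) -> \bar R}.

Definition mpowerS : set (n.+1.-tuple T) -> \bar R :=
  pushforward (nu \x mu)%E (@tcons n).

Let mpowerS0 : mpowerS set0 = 0%E. Proof. exact: measure0. Qed.

Let mpowerS_ge0 A : (0 <= mpowerS A)%E. Proof. exact: measure_ge0. Qed.

Let mpowerS_sigma_additive : semi_sigma_additive mpowerS.
Proof. exact: measure_semi_sigma_additive. Qed.

HB.instance Definition _ := isMeasure.Build _ _ _ mpowerS
  mpowerS0 mpowerS_ge0 mpowerS_sigma_additive.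

End mpowerS.

(** The product measure mu^(x)n on n.-tuple T. *)
Fixpoint mpower (mu : {sigma_finite_measure set T -> \bar R}) (n : nat) :
    {measure set (n.-tuple T) -> \bar R} :=
  if n is m.+1 then mpowerS mu (mpower mu m) else \d_ [tuple].

Definition set_tnth n (t : n.-tuple T) (i : 'I_n) (u : T) : n.-tuple T :=
  [tuple if j == i then u else tnth t j | j < n].

End finite_product.

(** Sequences of marks, with the product sigma-field. *)
Definition markseq (T : Type) := nat -> T.

Definition markseq_display : measure_display -> measure_display.
Proof. exact. Qed.

Section markseq_measurable.
Context d (T : measurableType d).

Definition markseq_gen : set (set (markseq T)) :=
  [set B | exists (k : nat) (A : set T),
    measurable A /\ B = [set y : markseq T | A (y k)]].

HB.instance Definition _ := gen_eqMixin (markseq T).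
HB.instance Definition _ := gen_choiceMixin (markseq T).
HB.instance Definition _ := isPointed.Build (markseq T) (fun=> point).
HB.instance Definition _ := @isMeasurable.Build (markseq_display d)
  (markseq T) <<s markseq_gen >> (@sigma_algebra0 _ setT markseq_gen)
  (@sigma_algebraC _ markseq_gen) (@sigma_algebra_bigcup _ setT markseq_gen).

Definition set_mark (y : markseq T) (k : nat) (u : T) : markseq T :=
  [eta y with k |-> u].

(** [muN] is the infinite product measure mu (x) mu (x) ...: the values below
    determine it uniquely. *)
Definition is_infinite_product (R : realType) (mu : probability T R)
    (muN : probability (markseq T) R) : Prop :=
  forall (n : nat) (A : nat -> set T), (forall i, measurable (A i)) ->
    muN [set y | forall i, (i < n)%N -> A i (y i)] =
    (\prod_(i < n) mu (A i))%E.

End markseq_measurable.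

(** * Dirichlet structures *)

Definition bounded_real (T : Type) (R : realType) (f : T -> R) : Prop :=
  exists M : R, forall x, `|f x| <= M.

(** Functions are representatives of their almost-everywhere class. *)
Section dirichlet.
Context d (T : measurableType d) (R : realType).
Variable nu : {measure set T -> \bar R}.
Variables (dom : set (T -> R)) (gamma : (T -> R) -> (T -> R) -> T -> R).

(** The form is half the integral of its carre du champ operator. *)
Definition energy (f g : T -> R) : R := 2^-1 * \int[nu]_x gamma f g x.

(** Squared graph norm. *)
Definition energy1 (f : T -> R) : R := \int[nu]_x (f x ^+ 2) + energy f f.

Definition supp (phi : R -> R) : set R := closure [set r | phi r != 0].

Definition smooth_compact_supp (phi : R -> R) : Prop :=
  (forall n r, derivable (derive1n n phi) r 1) /\ compact (supp phi).

(** The values of gamma outside of dom are irrelevant. *)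
Record local_dirichlet_structure : Prop := LocalDirichletStructure {
  dirichlet_L2 : forall f, dom f -> f \in Lfun nu 2%:E;
  dirichlet_ae : forall f g, dom f -> measurable_fun setT g ->
    f = g %[ae nu] -> dom g;
  dirichlet_linear : forall (a : R) f g, dom f -> dom g ->
    dom (fun x => a * f x + g x);
  dirichlet_dense : forall f, f \in Lfun nu 2%:E -> forall e : R, 0 < e ->
    exists2 g, dom g & \int[nu]_x ((f x - g x) ^+ 2) < e;
  gamma_integrable : forall f g, dom f -> dom g ->
    nu.-integrable setT (EFin \o gamma f g);
  gamma_ae : forall f f' g, dom f -> dom f' -> dom g ->
    f = f' %[ae nu] -> gamma f g = gamma f' g %[ae nu];
  gamma_sym : forall f g, dom f -> dom g -> gamma f g = gamma g f %[ae nu];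
  gamma_linear : forall (a : R) f f' g, dom f -> dom f' -> dom g ->
    gamma (fun x => a * f x + f' x) g =
    (fun x => a * gamma f g x + gamma f' g x) %[ae nu];
  gamma_ge0 : forall f, dom f -> {ae nu, forall x, 0 <= gamma f f x};
  dirichlet_closed : forall u : nat -> T -> R, (forall n, dom (u n)) ->
    (forall e : R, 0 < e -> exists N : nat, forall p q,
      (N <= p)%N -> (N <= q)%N -> energy1 (fun x => u p x - u q x) < e) ->
    exists2 f, dom f & forall e : R, 0 < e -> exists N : nat, forall p,
      (N <= p)%N -> energy1 (fun x => u p x - f x) < e;
  dirichlet_contraction : forall f, dom f ->
    let f1 := fun x => Num.min (Num.max (f x) 0) 1 in
    dom f1 /\ energy f1 f1 <= energy f f;
  gamma_carre_du_champ : forall f g h, dom f -> dom g -> dom h ->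
    bounded_real f -> bounded_real g -> bounded_real h ->
    energy (f \* h) g + energy (g \* h) f - energy h (f \* g) =
    \int[nu]_x (h x * gamma f g x);
  dirichlet_local : forall f (phi psi : R -> R), dom f ->
    smooth_compact_supp phi -> smooth_compact_supp psi ->
    supp phi `&` supp psi = set0 ->
    energy (fun x => phi (f x) - phi 0) (fun x => psi (f x) - psi 0) = 0 }.

Definition local_domain : set (T -> R) := [set f |
  measurable_fun setT f /\
  exists (W : nat -> set T) (g : nat -> T -> R),
    [/\ forall n, measurable (W n), \bigcup_n W n = setT,
        forall n, dom (g n) & forall n x, W n x -> f x = g n x]].

End dirichlet.

(** * Energy image density *)

(** A carre du champ operator only makes sense up to almost-everywhere equality;
    when it has to be assembled from the sections of a function, it is
    represented by the relation [q f h]: "h is a (measurable) version of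
    gamma[f] = gamma[f, f]".  [polarized q f g h] then means that h is a version
    of gamma[f, g]. *)
Definition polarized (T : Type) (R : realType)
    (q : (T -> R) -> (T -> R) -> Prop) (f g h : T -> R) : Prop :=
  exists hp hm, [/\ q (f \+ g) hp, q (f \- g) hm &
    forall x, h x = (hp x - hm x) / 4].

Section EID.
Context d (T : measurableType d) (R : realType).

Definition EID (nu : {measure set T -> \bar R}) (dom : set (T -> R))
    (q : (T -> R) -> (T -> R) -> Prop) : Prop :=
  forall (k : nat) (U : 'I_k -> T -> R) (G : 'I_k -> 'I_k -> T -> R),
    (0 < k)%N ->
    (forall i, dom (U i)) ->
    (forall i j, polarized q (U i) (U j) (G i j)) ->
    pushforward
      (fun A => \int[nu]_(x in A) (\det (\matrix_(i, j) G i j x))%:E)%E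
      (fun x => [tuple U i x | i < k] : k.-tuple (measurableTypeR R))
    `<< mpower lebesgue_measure k.

End EID.

(** * Finite product structures *)

Section product_structure.
Context d (T : measurableType d) (R : realType).
Variables (mu : {sigma_finite_measure set T -> \bar R}).
Variables (dom : set (T -> R)) (gamma : (T -> R) -> (T -> R) -> T -> R).
Variable n : nat.

(** g is a jointly measurable version of gamma_i[f]. *)
Definition prod_gamma_i (f : n.-tuple T -> R) (i : 'I_n) (g : n.-tuple T -> R) :
    Prop :=
  measurable_fun setT g /\
  {ae mpower mu n, forall t : n.-tuple T, {ae mu, forall u : T,
    g (set_tnth t i u) = gamma (f \o set_tnth t i) (f \o set_tnth t i) u}}.

Definition prod_gamma (f h : n.-tuple T -> R) : Prop :=
  measurable_fun setT h /\
  exists g : 'I_n -> n.-tuple T -> R,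
    (forall i, prod_gamma_i f i (g i)) /\
    {ae mpower mu n, forall t, h t = \sum_i g i t}.

Definition prod_dom : set (n.-tuple T -> R) := [set f |
  [/\ f \in Lfun (mpower mu n) 2%:E,
      forall i : 'I_n, {ae mpower mu n, forall t, dom (f \o set_tnth t i)} &
      exists2 h, prod_gamma f h & (\int[mpower mu n]_t (h t)%:E < +oo)%E]].

End product_structure.

(** * Marked configurations *)

Section marked.
Context dX (X : measurableType dX) dY (Y : measurableType dY) (R : realType).

Lemma countable_mark (m : config X) (y : markseq Y) :
  countable [set (x, y (numbering m x)) | x in (m : set X)].
Proof.
exact: sub_countable (card_image_le _ _) (countable_points m).
Qed.

(** The configuration {(x_1, y_1), (x_2, y_2), ...}; since the marks are
    independent and identically distributed, it is harmless that the numbering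
    of m may skip integers. *)
Definition mark (m : config X) (y : markseq Y) : config (X * Y) :=
  Config (countable_mark m y).

(** u |-> F({(x_1, y_1), ..., (x, u), ...}), u being the mark of the point x. *)
Definition mark_section (F : config (X * Y) -> R) (m : config X) (y : markseq Y)
    (x : X) (u : Y) : R :=
  F (mark m (set_mark y (numbering m x) u)).

Variables (Q : probability (config X) R) (mu : probability Y R).
Variable muN : probability (markseq Y) R.
Variable P : probability (config (X * Y)) R.

Definition mark_average (F : config (X * Y) -> R) (m : config X) : R :=
  \int[muN]_y F (mark m y).

Definition is_marked_law : Prop :=
  forall F : config (X * Y) -> R, measurable_fun setT F ->
    bounded_real F ->
    \int[P]_w F w = \int[Q]_m mark_average F m.

Variables (dom : set (Y -> R)) (gamma : (Y -> R) -> (Y -> R) -> Y -> R).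

(** [g w x] is, at w = {(x_1, u_1), (x_2, u_2), ...} and x = x_i, a version of
    gamma_i[F](w). *)
Definition upper_gamma_i (F : config (X * Y) -> R)
    (g : config (X * Y) -> X -> R) : Prop :=
  {ae Q, forall m : config X, forall x, points m x ->
    measurable_fun setT (fun y : markseq Y => g (mark m y) x) /\
    {ae muN, forall y : markseq Y, {ae mu, forall u : Y,
      g (mark m (set_mark y (numbering m x) u)) x =
      gamma (mark_section F m y x) (mark_section F m y x) u}}}.

(** h is a version of Gamma[F] = sum_i gamma_i[F]; the terms are almost
    everywhere nonnegative, and a real-valued h forces the sum to be finite. *)
Definition upper_gamma (F h : config (X * Y) -> R) : Prop :=
  measurable_fun setT h /\
  exists g, upper_gamma_i F g /\
    {ae Q, forall m : config X, {ae muN, forall y : markseq Y,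
      (h (mark m y))%:E = \esum_(x in m) (g (mark m y) x)%:E}}.

Definition upper_dom : set (config (X * Y) -> R) := [set F |
  [/\ F \in Lfun P 2%:E,
      {ae Q, forall m : config X, forall x, points m x ->
        {ae muN, forall y : markseq Y, dom (mark_section F m y x)}} &
      exists2 h, upper_gamma F h & (\int[P]_w (h w)%:E < +oo)%E]].

(** * The operators eps+ and eps-, and integration with respect to N *)

Definition epsp (F : config (X * Y) -> R) (w : config (X * Y)) (x : X) (u : Y) : R :=
  F (eps_plus w (x, u)).

Definition epsm (G : config (X * Y) -> X -> Y -> R) (w : config (X * Y)) (x : X)
    (u : Y) : R :=
  G (eps_minus w (x, u)) x u.

Definition integral_N (G : config (X * Y) -> X -> Y -> R) (w : config (X * Y)) :
    \bar R :=
  \esum_(z in w) (G w z.1 z.2)%:E.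

(** H is a version of gamma[eps+ F].  As eps- carries the mass of N to the points
    (w, x, u) with w = eps-_(x, y) (mark m y), x in m and u of law mu independent
    of w, this is where H has to agree with gamma[eps+ F]. *)
Definition gamma_epsp (F : config (X * Y) -> R)
    (H : config (X * Y) -> X -> Y -> R) : Prop :=
  measurable_fun setT (integral_N (epsm H)) /\
  {ae Q, forall m : config X, forall x, points m x ->
    measurable_fun setT
      (fun y : markseq Y => epsm H (mark m y) x (y (numbering m x))) /\
    {ae muN, forall y : markseq Y,
      let w := eps_minus (mark m y) (x, y (numbering m x)) in
      {ae mu, forall u : Y, H w x u = gamma (epsp F w x) (epsp F w x) u}}}.

End marked.

(* Main.v *)
Require Import Defs.
From HB Require Import structures.
From mathcomp Require Import all_boot all_order all_algebra.
From mathcomp Require Import finmap.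
From mathcomp Require Import all_classical all_reals all_analysis.
From mathcomp Require Import measurable_realfun.
From mathcomp Require Import lra.
Set Implicit Arguments.
Unset Strict Implicit.
Unset Printing Implicit Defensive.
Import Order.TTheory GRing.Theory Num.Theory.
Import numFieldNormedType.Exports.
Local Open Scope classical_set_scope.
Local Open Scope ring_scope.

(** Under P a configuration is [mark m y], where m has law Q and the marks y are
    independent of m with law mu, so everything is proved for a fixed m: an event
    of full probability on the sequences of marks for almost every m has full
    probability under P ([ae_marked]).

    The basic tool is resampling.  Replacing one mark by an independent copy
    preserves the law of the sequence of marks ([resample_integral]).  Hence a
    relation between measurable functions of y which, for almost every y, holds
    for almost every new value u of the k-th mark, holds for almost every y
    ([ae_of_resample]).  All the operators gamma_i act on one mark, and their
    versions are specified by relations of this second kind.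

    First assertion.  Deleting (x_i, u_i) and inserting (x_i, u) moves the mark of
    x_i to u ([eps_plus_minus_mark]).  The function to which gamma is applied in
    eps^- gamma[eps^+ F] at (x_i, u_i) is therefore the section of F in the i-th
    mark, and by resampling any version of eps^- gamma[eps^+ F] agrees almost
    everywhere with gamma_i[F] ([epsm_gamma]).  Summing over the points gives
    Gamma[F] ([upper_gamma_epsp]).  For the existence of a version whose integral
    with respect to N is measurable, gamma_i[F] is kept where it sums up to
    Gamma[F], and elsewhere the whole mass is given to a single point
    ([gamma_epsp_versionP]).

    Second assertion.  Let U have components in the upper domain and let B be
    Lebesgue-null.  Fix m and all the marks except those of finitely many points.
    The components of U, as functions of the remaining marks, belong to the domain
    of a finite product structure ([prod_dom_first_marks]), whose carre du champ
    is the partial sum Gamma_N of the gamma_i over these points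
    ([prod_gamma_first_marks]).  Its (EID) says that det Gamma_N has integral zero
    on {U in B}.  As Gamma_N is positive semidefinite ([point_matrix_psd]), its
    determinant is nonnegative ([det_psd_ge0]), so that it vanishes almost
    everywhere on {U in B}.  When N tends to infinity, Gamma_N tends to Gamma
    entrywise ([cvg_partial_matrix]), and det Gamma vanishes there as well
    ([det_gamma_matrix]).

    Going down to the finite products requires that a function which is integrable
    under P be integrable in the marks for almost every m.  The averages over the
    marks are not assumed to depend measurably on m; the law of P tested on F and
    on a constant minus F bounds them from both sides ([ae_average_lty]). *)

(** * Numberings and sequences of marks *)

Section configurations.
Context (T : Type).

Lemma config_ext (w w' : config T) : (w : set T) = w' -> w = w'.
Proof.
case: w w' => [A cA] [B cB] /= AB; subst B.
by congr Config; exact: Prop_irrelevance.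
Qed.

Lemma numbering_inj (w : config T) : set_inj w (numbering w).
Proof. by rewrite /numbering; case: cid. Qed.

End configurations.

Section mark_sequences.
Context d (Y : measurableType d) (R : realType).

Lemma set_markE (y : markseq Y) k u i :
  set_mark y k u i = if i == k then u else y i.
Proof. by []. Qed.

Lemma measurable_markseqP d' (T : measurableType d') (f : T -> markseq Y) :
  (forall i, measurable_fun setT (fun t => f t i)) <-> measurable_fun setT f.
Proof.
split => [mf|mf i].
  apply: (@measurability _ _ _ _ setT f (@markseq_gen _ Y)) => //.
  move=> _ [_ [i [A [mA ->]]] <-]; rewrite setTI.
  by have := mf i measurableT A mA; rewrite setTI.
apply: (@measurableT_comp _ _ _ _ _ _ (fun y : markseq Y => y i)) => //.
move=> _ A mA; rewrite setTI; apply: sub_sigma_algebra.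
by exists i, A.
Qed.

Lemma measurable_coordinate i :
  measurable_fun setT (fun y : markseq Y => y i).
Proof. exact: (measurable_markseqP id).2. Qed.

(** Joint measurability is what Fubini's theorem needs for [resample_integral]. *)
Lemma measurable_set_mark k :
  measurable_fun setT (fun p : markseq Y * Y => set_mark p.1 k p.2).
Proof.
apply/measurable_markseqP => i; have [->|ik] := eqVneq i k.
  under eq_fun do rewrite set_markE eqxx.
  exact: measurable_snd.
under eq_fun do rewrite set_markE (negbTE ik).
exact: (measurableT_comp (measurable_coordinate i) measurable_fst).
Qed.

Definition cylinder (A : nat -> set Y) n : set (markseq Y) :=
  [set y | forall i, (i < n)%N -> A i (y i)].

Definition cylinders : set (set (markseq Y)) :=
  [set B | exists A n, (forall i, measurable (A i)) /\ B = cylinder A n].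

Lemma measurable_cylinder A n :
  (forall i, measurable (A i)) -> measurable (cylinder A n).
Proof.
move=> mA.
have -> : cylinder A n =
    \bigcap_(i in [set i | (i < n)%N]) ((fun y : markseq Y => y i) @^-1` A i).
  by apply/seteqP; split => y /= yA i; apply: yA.
apply: bigcap_measurableType => // i _.
by have := measurable_coordinate i measurableT (mA i); rewrite setTI.
Qed.

Lemma sigma_cylinders : @measurable _ (markseq Y) = <<s cylinders >>.
Proof.
apply/seteqP; split.
  apply: smallest_sub; first exact: smallest_sigma_algebra.
  move=> _ [k [A [mA ->]]]; apply: sub_sigma_algebra.
  exists (fun i => if i == k then A else setT), k.+1; split.
    by move=> i; case: ifP.
  apply/seteqP; split => y /=.
    by move=> Ay i _; case: eqP => // ->.
  by move=> /(_ k (ltnSn k)); rewrite eqxx.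
apply: smallest_sub; first exact: sigma_algebra_measurable.
by move=> _ [A [n [mA ->]]]; exact: measurable_cylinder.
Qed.

Lemma setI_closed_cylinders : setI_closed cylinders.
Proof.
move=> _ _ [A [n [mA ->]]] [B [p [mB ->]]].
exists (fun i => (if (i < n)%N then A i else setT) `&`
                 (if (i < p)%N then B i else setT)), (maxn n p); split.
  by move=> i; apply: measurableI; case: ifP.
apply/seteqP; split => y /=.
  by move=> [yA yB] i _; split; case: ifP => // ?; [exact: yA|exact: yB].
move=> yAB; split => i ilt.
  by have [] := yAB i (leq_trans ilt (leq_maxl _ _)); rewrite ilt.
by have [_] := yAB i (leq_trans ilt (leq_maxr _ _)); rewrite ilt.
Qed.

Section infinite_product.
Variables (mu : probability Y R) (muN : probability (markseq Y) R).
Hypothesis muN_prod : is_infinite_product mu muN.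

(** The two measures agree on cylinders, where the k-th factor of the product is
    now provided by the independent mark, and cylinders form a generating
    pi-system. *)
Lemma resample_pushforward k (B : set (markseq Y)) : measurable B ->
  pushforward (muN \x mu)%E (fun p : markseq Y * Y => set_mark p.1 k p.2) B =
  muN B.
Proof.
pose phi := fun p : markseq Y * Y => set_mark p.1 k p.2.
have mphi : measurable_fun setT phi := measurable_set_mark k.
pose phi' : {mfun _ >-> _} := HB.pack phi (isMeasurableFun.Build _ _ _ _ phi mphi).
apply: (measure_unique cylinders (fun=> setT) sigma_cylinders
  setI_closed_cylinders _ _ (pushforward (muN \x mu)%E phi') muN) => //.
- by move=> _; exists (fun=> setT), 0%N; split => //; apply/seteqP; split.
- by rewrite bigcup_const; last by exists 0%N.
- move=> _ [A [n [mA ->]]].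
  pose A' i := if i == k then setT else A i.
  have mA' i : measurable (A' i) by rewrite /A'; case: ifP.
  pose Ak := if (k < n)%N then A k else setT.
  have mAk : measurable Ak by rewrite /Ak; case: ifP.
  rewrite [LHS](_ : _ = (muN \x mu)%E (phi @^-1` cylinder A n))//.
  have -> : phi @^-1` cylinder A n = cylinder A' n `*` Ak.
    apply/seteqP; split => -[y u] /=.
      rewrite /cylinder/= /phi/= => yA; split.
        move=> i ilt; rewrite /A'; case: ifPn => // /negbTE ik.
        by have := yA i ilt; rewrite set_markE ik.
      by rewrite /Ak; case: ifPn => // /yA; rewrite set_markE eqxx.
    rewrite /cylinder/= /phi/= => -[yA uA] i ilt; rewrite set_markE.
    case: eqP => [ik|/eqP /negbTE ik].
      by move: uA; rewrite /Ak -ik ilt.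
    by have := yA i ilt; rewrite /A' ik.
  rewrite product_measure1E //; last exact: measurable_cylinder.
  rewrite [X in (X * _)%E](muN_prod n mA') [RHS](muN_prod n mA).
  have [kn|nk] := ltnP k n; last first.
    rewrite /Ak ltnNge nk/= probability_setT mule1.
    apply: eq_bigr => i _; rewrite /A'; case: eqP => // ik.
    by have := ltn_ord i; rewrite ik ltnNge nk.
  rewrite /Ak kn (bigD1 (Ordinal kn))//= [RHS](bigD1 (Ordinal kn))//=.
  rewrite /A' eqxx probability_setT mul1e muleC; congr (_ * _)%E.
  apply: eq_bigr => i /negbTE ik; case: eqP => // ik'.
  by move: ik; rewrite -val_eqE/= ik' eqxx.
- move=> _; rewrite [X in (X < _)%E](_ : _ = (muN \x mu)%E (setT `*` setT)).
    rewrite product_measure1E// [X in (X < _)%E](_ : _ = (1 * 1)%E).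
      by rewrite mule1 ltry.
    by congr (_ * _)%E; exact: probability_setT.
  by rewrite setXTT.
Qed.

Local Open Scope ereal_scope.

Lemma measurable_resample_integral k (f : markseq Y -> \bar R) :
  measurable_fun setT f -> (forall y, 0 <= f y) ->
  measurable_fun setT (fun y => \int[mu]_u f (set_mark y k u)).
Proof.
move=> mf f0.
apply: (measurable_fun_fubini_tonelli_F (fun p => f (set_mark p.1 k p.2))) => //.
exact: (measurableT_comp mf (measurable_set_mark k)).
Qed.

(** Fubini's theorem applied to [resample_pushforward]. *)
Lemma resample_integral k (f : markseq Y -> \bar R) :
  measurable_fun setT f -> (forall y, 0 <= f y) ->
  \int[muN]_y \int[mu]_u f (set_mark y k u) = \int[muN]_y f y.
Proof.
move=> mf f0.
pose g (p : markseq Y * Y) := f (set_mark p.1 k p.2).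
have mg : measurable_fun setT g.
  exact: (measurableT_comp mf (measurable_set_mark k)).
rewrite -[LHS](fubini_tonelli1 g)//; last by move=> x; exact: f0.
pose phi := fun p : markseq Y * Y => set_mark p.1 k p.2.
have mphi : measurable_fun setT phi := measurable_set_mark k.
pose phi' : {mfun _ >-> _} := HB.pack phi (isMeasurableFun.Build _ _ _ _ phi mphi).
rewrite -[LHS](@ge0_integral_pushforward _ _ _ _ R phi mphi
  (muN \x mu) setT f)//.
by apply: (@eq_measure_integral _ _ _ setT muN
  (pushforward (muN \x mu) phi')) => A mA _; exact: resample_pushforward.
Qed.

End infinite_product.
End mark_sequences.

(** * Replacing finitely many marks *)

(** [mpower] is presented as a mere measure, while Fubini's theorem asks for a
    sigma-finite one; this is recovered from its total mass. *)
Section unit_mass.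
Context d (T : measurableType d) (R : realType).
Variables (nu : {measure set T -> \bar R}) (nu1 : nu setT = 1%E).

Definition unit_mass of nu setT = 1%E : set T -> \bar R := fun A => nu A.

Local Notation P := (unit_mass nu1).

Let P0 : P set0 = 0%E. Proof. exact: measure0. Qed.

Let P_ge0 A : (0 <= P A)%E. Proof. exact: measure_ge0. Qed.

Let P_sigma_additive : semi_sigma_additive P.
Proof. exact: measure_semi_sigma_additive. Qed.

HB.instance Definition _ := isMeasure.Build _ _ _ P
  P0 P_ge0 P_sigma_additive.

HB.instance Definition _ := Measure_isProbability.Build _ _ _ P nu1.

End unit_mass.

Section merge.
Context d (Y : measurableType d) (R : realType).

(** An index outside of [c] is sent by [index] to the size of [c], which is also
    that of [t] in all uses: the default value of [nth], the old mark, is then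
    taken. *)
Definition merge (c : seq nat) (t : seq Y) (y : markseq Y) : markseq Y :=
  fun k => nth (y k) t (index k c).

Lemma merge_cons k c u t y :
  merge (k :: c) (u :: t) y = set_mark (merge c t y) k u.
Proof.
by apply/funext => i; rewrite set_markE /merge/= eq_sym; case: eqP.
Qed.

(** Turns the sections of a function of all the marks into sections on the finite
    product. *)
Lemma set_mark_merge n (c : seq nat) (cn : size c = n) (t : n.-tuple Y) y
    (i : 'I_n) u : uniq c ->
  set_mark (merge c t y) (nth 0%N c i) u = merge c (set_tnth t i u) y.
Proof.
move=> uc; apply/funext => k; rewrite set_markE /merge.
have [kc|kc] := boolP (k \in c); last first.
  rewrite !(@nth_default _ (y k)) ?size_tuple ?memNindex ?cn//.
  by case: eqP => // kE; move: kc; rewrite kE mem_nth// cn.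
have ic : (index k c < n)%N by rewrite -cn index_mem.
rewrite (_ : index k c = Ordinal ic)// -tnth_nth -[in RHS]tnth_nth.
rewrite tnth_mktuple.
have -> : (k == nth 0%N c i) = (Ordinal ic == i); last by [].
rewrite -val_eqE/=; apply/eqP/eqP => [->|<-]; last by rewrite nth_index.
by rewrite index_uniq// cn; exact: ltn_ord.
Qed.

Lemma measurable_merge n (c : seq nat) (y : markseq Y) :
  measurable_fun setT (fun t : n.-tuple Y => merge c t y).
Proof.
apply/measurable_markseqP => k; rewrite /merge.
have [ic|ic] := ltnP (index k c) n; last first.
  under eq_fun do rewrite nth_default ?size_tuple//.
  exact: measurable_cst.
under eq_fun => t do rewrite (_ : index k c = Ordinal ic)// -tnth_nth.
exact: measurable_tnth.
Qed.

Section merge_integral.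
Variables (mu : probability Y R) (muN : probability (markseq Y) R).
Hypothesis muN_prod : is_infinite_product mu muN.

Local Open Scope ereal_scope.

Lemma mpower_setT n : mpower mu n setT = 1.
Proof.
elim: n => [|n IHn]/=; first by rewrite diracT.
rewrite [LHS](_ : _ = (mpower mu n \x mu) (setT `*` setT)).
  rewrite product_measure1E// IHn mul1e; exact: probability_setT.
by rewrite setXTT.
Qed.

Definition mpowerP n : probability (n.-tuple Y) R :=
  unit_mass (mpower_setT n).

Lemma integral_mpowerS n (f : n.+1.-tuple Y -> \bar R) :
  measurable_fun setT f -> (forall t, 0 <= f t) ->
  \int[mpower mu n.+1]_t f t =
  \int[mpower mu n]_t \int[mu]_u f (tcons (t, u)).
Proof.
move=> mf f0.
rewrite (@ge0_integral_pushforward _ _ _ _ R _ (@measurable_tcons _ Y n)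
  (mpower mu n \x mu) setT f)// preimage_setT.
rewrite [LHS](_ : _ = \int[mpowerP n \x mu]_z (f \o @tcons _ Y n) z)//.
rewrite fubini_tonelli1//.
  exact: (measurableT_comp mf (@measurable_tcons _ Y n)).
by move=> ?; exact: f0.
Qed.

(** Iterate [resample_integral] along [c]; the inner integrals remain measurable
    functions of the old marks, which is proved at the same time. *)
Lemma merge_integral n (c : seq nat) (f : markseq Y -> \bar R) :
  size c = n -> measurable_fun setT f -> (forall y, 0 <= f y) ->
  measurable_fun setT (fun y => \int[mpower mu n]_t f (merge c t y)) /\
  \int[muN]_y \int[mpower mu n]_t f (merge c t y) = \int[muN]_y f y.
Proof.
elim: n c f => [|n IHn] [|k c] f //=.
  move=> _ mf f0.
  suff E y : \int[\d_ [tuple]]_t f (merge [::] (t : 0.-tuple Y) y) = f y.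
    by split; [under eq_fun do rewrite E|under eq_integral do rewrite E].
  have -> : (fun t : 0.-tuple Y => f (merge [::] t y)) = cst (f y).
    by apply/funext => t; rewrite (tuple0 t).
  rewrite integral_cst// -[RHS]mule1; congr (_ * _); exact: (mpower_setT 0).
move=> [cn] mf f0.
have mf' := measurable_resample_integral mu k mf f0.
have f'0 y : 0 <= \int[mu]_u f (set_mark y k u) by exact: integral_ge0.
have [m1 i1] := IHn c _ cn mf' f'0.
suff E y : \int[mpower mu n.+1]_t f (merge (k :: c) t y) =
    \int[mpower mu n]_t \int[mu]_u f (set_mark (merge c t y) k u).
  split; first by under eq_fun do rewrite E.
  by under eq_integral do rewrite E; rewrite i1; exact: (resample_integral muN_prod).
have mg : measurable_fun setT (fun t : n.+1.-tuple Y => f (merge (k :: c) t y)).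
  exact: (measurableT_comp mf (@measurable_merge n.+1 (k :: c) y)).
rewrite [LHS](integral_mpowerS mg (fun=> f0 _)).
by apply: eq_integral => t _; apply: eq_integral => u _; rewrite -merge_cons.
Qed.

End merge_integral.
End merge.

(** Resampling one mark and resampling finitely many of them are both maps [phi]
    such that integrating [f (phi t y)] in t and then in y gives the integral of f.
    The transfer of null sets only depends on this identity. *)
Section disintegration.
Context d (T : measurableType d) d' (S : measurableType d') (R : realType).
Variables (P : {measure set T -> \bar R}) (nu : {measure set S -> \bar R}).
Variable phi : S -> T -> T.
Hypothesis mphi : forall y, measurable_fun setT (phi ^~ y).
Hypothesis phi_integral : forall f : T -> \bar R,
  measurable_fun setT f -> (forall y, 0 <= f y)%E ->
  measurable_fun setT (fun y => \int[nu]_t f (phi t y))%E /\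
  (\int[P]_y \int[nu]_t f (phi t y) = \int[P]_y f y)%E.

Let integral_section N y : measurable N ->
  (\int[nu]_t (\1_N (phi t y))%:E = nu [set t | N (phi t y)])%E.
Proof.
move=> mN; have mN' : measurable ((phi ^~ y) @^-1` N).
  by have := mphi y measurableT mN; rewrite setTI.
by rewrite -[X in nu X](setIT [set t | N (phi t y)]) -integral_indic.
Qed.

Let mindic N : measurable N ->
  measurable_fun setT (fun y : T => (\1_N y)%:E : \bar R).
Proof. by move=> mN; exact/measurable_EFinP/measurable_indic. Qed.

Let indic0 (N : set T) y : (0 <= (\1_N y)%:E :> \bar R)%E.
Proof. by rewrite lee_fin. Qed.

Lemma ae_disintegrate (A : T -> Prop) :
  {ae P, forall y, A y} -> {ae P, forall y, {ae nu, forall t, A (phi t y)}}.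
Proof.
move=> [N [mN N0 AN]].
have [m1 i1] := phi_integral (mindic mN) (indic0 N).
move: i1; rewrite integral_indic// setIT N0 => i1.
have ge0 y : (0 <= \int[nu]_t (\1_N (phi t y))%:E)%E by exact: integral_ge0.
have : (\int[P]_y `| \int[nu]_t (\1_N (phi t y))%:E | = 0)%E.
  by under eq_integral do rewrite gee0_abs//.
move/(ae_eq_integral_abs _ measurableT m1).
apply: filterS => y /(_ I); rewrite integral_section// => NE.
exists [set t | N (phi t y)]; split => //.
  by have := mphi y measurableT mN; rewrite setTI.
by move=> t /= At; apply: AN.
Qed.

(** The integral identity is applied to the indicator function of the complement of
    [A]; this is why versions have to be measurable in the marks. *)
Lemma ae_integrate (A : set T) : measurable A ->
  {ae P, forall y, {ae nu, forall t, A (phi t y)}} -> {ae P, forall y, A y}.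
Proof.
move=> mA AP; exists (~` A); split => //; first exact: measurableC.
have mC := measurableC mA.
have [m1 i1] := phi_integral (mindic mC) (indic0 _).
move: i1; rewrite integral_indic// setIT => <-.
have ge0 y : (0 <= \int[nu]_t (\1_(~` A) (phi t y))%:E)%E by exact: integral_ge0.
transitivity (\int[P]_y `| \int[nu]_t (\1_(~` A) (phi t y))%:E |)%E.
  by apply: eq_integral => y _; rewrite gee0_abs.
apply/(ae_eq_integral_abs _ measurableT m1).
move: AP; apply: filterS => y Ay _; rewrite integral_section//.
have mS : measurable [set t | (~` A) (phi t y)].
  by have := mphi y measurableT mC; rewrite setTI.
exact/(negligibleP _ mS).
Qed.

Lemma ae_integral_lty (f : T -> \bar R) : measurable_fun setT f ->
  (forall y, 0 <= f y)%E -> (\int[P]_y f y < +oo)%E ->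
  {ae P, forall y, (\int[nu]_t f (phi t y) < +oo)%E}.
Proof.
move=> mf f0; have [m1 <-] := phi_integral mf f0 => foo.
have ge0 y : (0 <= \int[nu]_t f (phi t y))%E by exact: integral_ge0.
have : P.-integrable setT (fun y => \int[nu]_t f (phi t y))%E.
  apply/integrableP; split => //.
  by under eq_integral do rewrite gee0_abs//.
move/(integrable_ae measurableT); apply: filterS => y /(_ I).
by rewrite fin_numElt => /andP[].
Qed.

End disintegration.

Section independent_marks.
Context d (Y : measurableType d) (R : realType).
Variables (mu : probability Y R) (muN : probability (markseq Y) R).
Hypothesis muN_prod : is_infinite_product mu muN.

Lemma measurable_set_mark_section k (y : markseq Y) :
  measurable_fun setT (fun u : Y => set_mark y k u).
Proof.
apply/measurable_markseqP => i; have [->|ik] := eqVneq i k.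
  by under eq_fun do rewrite set_markE eqxx; exact: measurable_id.
by under eq_fun do rewrite set_markE (negbTE ik); exact: measurable_cst.
Qed.

Lemma ae_resample k (A : markseq Y -> Prop) : {ae muN, forall y, A y} ->
  {ae muN, forall y, {ae mu, forall u, A (set_mark y k u)}}.
Proof.
apply: (ae_disintegrate (phi := fun u y => set_mark y k u)).
  exact: measurable_set_mark_section.
move=> f mf f0; split; first exact: measurable_resample_integral.
exact: (resample_integral muN_prod).
Qed.

Lemma ae_of_resample k (A : set (markseq Y)) : measurable A ->
  {ae muN, forall y, {ae mu, forall u, A (set_mark y k u)}} ->
  {ae muN, forall y, A y}.
Proof.
apply: (ae_integrate (phi := fun u y => set_mark y k u)).
  exact: measurable_set_mark_section.
move=> f mf f0; split; first exact: measurable_resample_integral.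
exact: (resample_integral muN_prod).
Qed.

Section finitely_many_marks.
Variables (n : nat) (c : seq nat) (cn : size c = n).

Let phi_integral (f : markseq Y -> \bar R) :=
  @merge_integral _ Y R mu muN muN_prod n c f cn.

Lemma ae_merge (A : markseq Y -> Prop) : {ae muN, forall y, A y} ->
  {ae muN, forall y, {ae mpower mu n, forall t : n.-tuple Y, A (merge c t y)}}.
Proof.
apply: (ae_disintegrate (phi := fun t : n.-tuple Y => merge c t)).
  exact: measurable_merge.
exact: phi_integral.
Qed.

Lemma ae_of_merge (A : set (markseq Y)) : measurable A ->
  {ae muN, forall y, {ae mpower mu n, forall t : n.-tuple Y, A (merge c t y)}} ->
  {ae muN, forall y, A y}.
Proof.
apply: (ae_integrate (phi := fun t : n.-tuple Y => merge c t)).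
  exact: measurable_merge.
exact: phi_integral.
Qed.

Lemma ae_merge_lty (f : markseq Y -> \bar R) : measurable_fun setT f ->
  (forall y, 0 <= f y)%E -> (\int[muN]_y f y < +oo)%E ->
  {ae muN, forall y, (\int[mpower mu n]_t f (merge c t y) < +oo)%E}.
Proof.
apply: (ae_integral_lty (phi := fun t : n.-tuple Y => merge c t)).
exact: phi_integral.
Qed.

End finitely_many_marks.
End independent_marks.

(** * Marking a configuration *)

Section marking.
Context dX (X : measurableType dX) dY (Y : measurableType dY).
Implicit Types (m : config X) (y : markseq Y).

Lemma numbering_eq m x x' : points m x -> points m x' ->
  numbering m x = numbering m x' -> x = x'.
Proof.
by move=> mx mx' E; apply: (@numbering_inj _ m); rewrite ?inE.
Qed.

Lemma mark_inj_in m y : set_inj m (fun x => (x, y (numbering m x))).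
Proof. by move=> x x' _ _ []. Qed.

Lemma mark_set_mark_at m y x u x' : points m x -> points m x' -> x' <> x ->
  set_mark y (numbering m x) u (numbering m x') = y (numbering m x').
Proof.
move=> mx mx' xx'; rewrite set_markE; case: eqP => // E.
by case: xx'; exact: numbering_eq E.
Qed.

(** By injectivity of the numbering, [set_mark] leaves the marks of the other
    points unchanged. *)
Lemma eps_plus_minus_mark m y x u : points m x ->
  eps_plus (eps_minus (mark m y) (x, y (numbering m x))) (x, u) =
  mark m (set_mark y (numbering m x) u).
Proof.
move=> mx; apply: config_ext; apply/seteqP; split => -[x' u'] /=.
  move=> [[[x1 mx1 [<- <-]] ne]|[-> ->]].
    exists x1 => //; rewrite mark_set_mark_at// => E.
    by apply: ne; rewrite E.
  by exists x => //; rewrite set_markE eqxx.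
move=> [x1 mx1 [<- <-]].
have [->|ne] := pselect (x1 = x); first by right; rewrite set_markE eqxx.
left; rewrite mark_set_mark_at//; split; first by exists x1.
by move=> [].
Qed.

Lemma eps_plus_minus_id (w : config (X * Y)) z : points w z ->
  eps_plus (eps_minus w z) z = w.
Proof.
move=> wz; apply: config_ext; apply/seteqP; split => z' /=.
  by move=> [[]|->].
by move=> wz'; have [->|] := pselect (z' = z); [right|left].
Qed.

Lemma eps_minus_set_mark m y x u : points m x ->
  eps_minus (mark m (set_mark y (numbering m x) u)) (x, u) =
  eps_minus (mark m y) (x, y (numbering m x)).
Proof.
move=> mx; apply: config_ext; apply/seteqP; split => -[x' u'] /=.
  move=> [[x1 mx1 [<- <-]] ne].
  have [E|x1x] := pselect (x1 = x).
    by case: ne; rewrite E set_markE eqxx.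
  by rewrite mark_set_mark_at//; split; [exists x1|move=> []].
move=> [[x1 mx1 [<- <-]] ne].
have x1x : x1 <> x by move=> E; apply: ne; rewrite E.
by split; [exists x1 => //; rewrite mark_set_mark_at|move=> []].
Qed.

Lemma esum_mark (R : realType) m y (a : X * Y -> \bar R) :
  (\esum_(z in mark m y) a z = \esum_(x in m) a (x, y (numbering m x)))%E.
Proof. exact/esum_image/mark_inj_in. Qed.

(** The number of points of [mark m y] in [A] is the number of indices [i] such
    that the point numbered [i] lies in [A]: a countable family of events. *)
Lemma measurable_mark m : measurable_fun setT (@mark _ X _ Y m).
Proof.
apply: (@measurability _ _ _ _ setT _ (@config_gen _ (X * Y)%type)) => //.
move=> _ [_ [A [k [mA ->]]] <-]; rewrite setTI.
pose J y : set nat :=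
  [set i | exists x, [/\ points m x, numbering m x = i & A (x, y i)]].
have mJ i : measurable [set y | J y i].
  have [[x [mx xi]]|nox] := pselect (exists x, points m x /\ numbering m x = i).
    rewrite (_ : [set y | J y i] = (fun y => y i) @^-1` xsection A x).
      have := measurable_coordinate i measurableT (measurable_xsection x mA).
      by rewrite setTI.
    apply/seteqP; split => y /=; rewrite xsectionE/=.
      move=> [x' [mx' xi' Ax']]; rewrite /xsection/=.
      by rewrite -(numbering_eq mx' mx)// xi'.
    by move=> Ax; exists x; split.
  rewrite (_ : [set y | J y i] = set0)//; apply/seteqP; split => // y [x [mx xi _]].
  by apply: nox; exists x.
have JE y : ((mark m y `&` A) #= J y)%card.
  pose B := [set x | points m x /\ A (x, y (numbering m x))].
  have -> : (mark m y `&` A) = [set (x, y (numbering m x)) | x in B].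
    apply/seteqP; split => -[x u] /=.
      by move=> [[x' mx' [<- <-]] Ax']; exists x'.
    by move=> [x' [mx' Ax'] [<- <-]]; split => //; exists x'.
  have -> : J y = [set numbering m x | x in B].
    apply/seteqP; split => i /=.
      by move=> [x [mx xi Ax]]; exists x => //; split => //; rewrite xi.
    by move=> [x [mx Ax] xi]; exists x; split => //; rewrite -xi.
  apply: (card_eq_trans (inj_card_eq _)).
    by move=> x x' _ _ [].
  rewrite card_eq_sym; apply: inj_card_eq => x x'; rewrite !inE => -[mx _] [mx' _].
  exact: numbering_eq.
have -> : mark m @^-1` [set w | ((w `&` A) #= `I_k)%card] =
    \bigcup_(F : {fset nat}) [set y | size F = k /\ J y = [set` F]].
  apply/seteqP; split => y /=.
    move=> wk; have Jk : (J y #= `I_k)%card.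
      exact: card_eq_trans (card_esym (JE y)) wk.
    have finJ : finite_set (J y) by apply/finite_setP; exists k.
    exists (fset_set (J y)) => //=; split; last by rewrite fset_setK.
    exact: card_fset_set.
  move=> [F _ /= [Fk JF]]; apply: (card_eq_trans (JE y)).
  by rewrite JF; apply/card_eq_fsetP.
apply: countable_bigcupT_measurable => // F.
have [Fk|Fk] := eqVneq (size F) k; last first.
  rewrite (_ : [set _ | _] = set0)//; apply/seteqP; split => // y [E _].
  by rewrite E eqxx in Fk.
rewrite (_ : [set _ | _] =
    \bigcap_i (if i \in F then [set y | J y i] else ~` [set y | J y i])).
  apply: bigcap_measurableType => // i _; case: ifP => _ //.
  exact: measurableC.
apply/seteqP; split => y /=.
  by move=> [_ JF] i _; case: ifPn => /=; rewrite JF/=// => /negP.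
move=> JF; split => //; apply/seteqP; split => i /=.
  by move=> Ji; have := JF i I; case: ifP.
by move=> iF; have := JF i I; rewrite iF.
Qed.

End marking.

(** * The law of the marked configuration *)

Lemma fin_num_summands (R : realDomainType) (a b : \bar R) (r : R) :
  (0 <= a)%E -> (0 <= b)%E -> (a + b = r%:E)%E ->
  exists p q, [/\ a = p%:E, b = q%:E & p + q = r].
Proof.
by case: a => [p| |]//; case: b => [q| |]// _ _ [pq]; exists p, q.
Qed.

(** The average of a function over the marks is not known to be a measurable
    function of the configuration; only the part of integration theory which
    comes from the approximation from below by simple functions applies to it. *)
Section integrals_without_measurability.
Context d (T : measurableType d) (R : realType).
Variable nu : {measure set T -> \bar R}.
Import HBNNSimple.
Local Open Scope ereal_scope.

Lemma integral_ae0 (f : T -> \bar R) : (forall x, 0 <= f x) ->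
  {ae nu, forall x, f x = 0} -> \int[nu]_x f x = 0.
Proof.
move=> f0 fae; rewrite ge0_integralTE//; apply/eqP; rewrite eq_le.
apply/andP; split; last first.
  by apply: ereal_sup_ubound; exists nnsfun0 => //; exact: sintegral0.
apply: ge_ereal_sup => _ [h hf <-]; rewrite -integralT_nnsfun.
rewrite (ae_eq_integral (cst 0)) ?integral0//; first exact/measurable_EFinP.
move: fae; apply: filterS => x fx0 _ /=; have := hf x.
rewrite fx0 => hx0; apply/eqP; rewrite eq_le hx0 lee_fin; exact: fun_ge0.
Qed.

Lemma nnsfun_below (f : T -> \bar R) (r : R) : (forall x, 0 <= f x) ->
  r%:E < \int[nu]_x f x ->
  exists h : {nnsfun T >-> R}, (forall x, (h x)%:E <= f x) /\
    r%:E < \int[nu]_x (h x)%:E.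
Proof.
move=> f0; rewrite ge0_integralTE// => /ereal_sup_gt[_ [h hf <-] rh].
by exists h; rewrite integralT_nnsfun.
Qed.

Lemma le_limn_einf (u v : (\bar R)^nat) : (forall n, u n <= v n) ->
  limn_einf u <= limn_einf v.
Proof.
move=> uv; rewrite !limn_einf_lim; apply: lee_lim.
- exact: is_cvg_einfs.
- exact: is_cvg_einfs.
- apply: nearW => n; apply: le_ereal_inf_tmp => _ [k nk <-].
  by apply: ge_ereal_inf; exists (u k) => //; exists k.
Qed.

End integrals_without_measurability.

Section marked_law.
Context dX (X : measurableType dX) dY (Y : measurableType dY) (R : realType).
Variables (Q : probability (config X) R) (muN : probability (markseq Y) R).
Variable P : probability (config (X * Y)) R.
Hypothesis P_law : is_marked_law Q muN P.
Import HBNNSimple.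

Lemma ae_marked (A : set (config (X * Y))) : measurable A ->
  {ae Q, forall m, {ae muN, forall y, A (mark m y)}} -> {ae P, forall w, A w}.
Proof.
move=> mA Aae; have mE := measurableC mA.
exists (~` A); split => //.
have mI : measurable_fun setT (\1_(~` A) : config (X * Y) -> R).
  exact: measurable_indic.
have bI : bounded_real (\1_(~` A) : config (X * Y) -> R).
  by exists 1 => w; rewrite indicE; case: (_ \in _); rewrite ?normr1 ?normr0.
have := P_law mI bI; rewrite /Rintegral.
rewrite integral_indic// setIT.
have av0 m : (0 <= (mark_average muN (\1_(~` A) : _ -> R) m)%:E)%E.
  by rewrite lee_fin fine_ge0// integral_ge0// => y _; rewrite lee_fin.
rewrite (@integral_ae0 _ _ _ Q (fun m => (mark_average muN \1_(~` A) m)%:E))//.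
  move=> H; rewrite -[LHS]fineK ?H//; first exact: fin_num_measure.
move: Aae; apply: filterS => m mae; rewrite /mark_average /Rintegral.
rewrite integral_ae0//.
by move: mae; apply: filterS => y Ay; rewrite indicE memNset.
Qed.

(** Truncate F at j.  As j - min (F, j) is nonnegative and bounded, the law of P
    gives the integral of its average over the marks, and a simple function s_j
    below this average has nearly the same integral.  Then j - s_j is a measurable
    majorant of the average of min (F, j), with integral at most that of F plus 1.
    By Fatou's lemma the lower limit of these majorants is integrable, hence finite
    almost everywhere, and it dominates the average of F. *)
Lemma ae_average_lty (F : config (X * Y) -> R) : measurable_fun setT F ->
  (forall w, 0 <= F w) -> (\int[P]_w (F w)%:E < +oo)%E ->
  {ae Q, forall m, (\int[muN]_y (F (mark m y))%:E < +oo)%E}.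
Proof.
move=> mF F0 Foo.
pose C := fine (\int[P]_w (F w)%:E)%E.
have F_C : (\int[P]_w (F w)%:E = C%:E)%E.
  by rewrite fineK// ge0_fin_numE// integral_ge0// => w _; rewrite lee_fin.
have int0 d (T : measurableType d) (p : {measure set T -> \bar R}) (f : T -> R) :
    (forall x, 0 <= f x) -> (0 <= \int[p]_x (f x)%:E)%E.
  by move=> f0; apply: integral_ge0 => x _; rewrite lee_fin.
pose Fj j w := Num.min (F w) j%:R.
pose Gj j w := j%:R - Fj j w.
have mFj j : measurable_fun setT (Fj j) by exact: measurable_minr.
have mGj j : measurable_fun setT (Gj j) by exact: measurable_funB.
have Fj0 j w : 0 <= Fj j w by rewrite /Fj le_min F0 ler0n.
have Gj0 j w : 0 <= Gj j w by rewrite /Gj subr_ge0 /Fj ge_min lexx orbT.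
have sum_j d (T : measurableType d) (p : probability T R) (f g : T -> R) j :
    measurable_fun setT f -> measurable_fun setT g ->
    (forall x, 0 <= f x) -> (forall x, 0 <= g x) ->
    (forall x, f x + g x = j%:R) ->
    (\int[p]_x (f x)%:E + \int[p]_x (g x)%:E = j%:R%:E)%E.
  move=> mf mg f0 g0 fg; rewrite -ge0_integralD//.
  - under eq_integral do rewrite -EFinD fg.
    rewrite integral_cst// -[RHS]mule1; congr (_ * _)%E.
    exact: probability_setT.
  - by move=> x _; rewrite lee_fin.
  - exact/measurable_EFinP.
  - by move=> x _; rewrite lee_fin.
  - exact/measurable_EFinP.
have FGj j w : Fj j w + Gj j w = j%:R by rewrite /Gj addrC subrK.
have FGm j m : (\int[muN]_y (Fj j (mark m y))%:E +
    \int[muN]_y (Gj j (mark m y))%:E = j%:R%:E)%E.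
  by apply: sum_j => //; exact: (measurableT_comp _ (measurable_mark m)).
pose phi j m := mark_average muN (Gj j) m.
have phiE j m : (phi j m)%:E = (\int[muN]_y (Gj j (mark m y))%:E)%E.
  rewrite fineK// ge0_fin_numE; last first.
    by rewrite integral_ge0// => y _; rewrite lee_fin.
  apply: (@le_lt_trans _ _ j%:R%:E); last exact: ltry.
  rewrite -(FGm j m) leeDr// integral_ge0// => y _; by rewrite lee_fin.
have phi0 j m : (0 <= (phi j m)%:E)%E.
  by rewrite phiE integral_ge0// => y _; rewrite lee_fin.
(* The law of P is an identity between real numbers, where an infinite integral
   counts as 0; an infinite integral satisfies the lower bound anyway. *)
have phi_int j : ((j%:R - C - 1)%:E < \int[Q]_m (phi j m)%:E)%E.
  have phi_int0 : (0 <= \int[Q]_m (phi j m)%:E)%E by exact: integral_ge0.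
  have bG : bounded_real (Gj j).
    exists j%:R => w; rewrite ger0_norm// /Gj lerBlDr lerDl; exact: Fj0.
  have := P_law (mGj j) bG.
  rewrite /Rintegral -/(phi j) => law.
  have : (j%:R - C <= fine (\int[Q]_m (phi j m)%:E)%E).
    rewrite -law.
    have [] := fin_num_summands (int0 _ _ P _ (Fj0 j)) (int0 _ _ P _ (Gj0 j))
      (sum_j _ _ P _ _ j (mFj j) (mGj j) (Fj0 j) (Gj0 j) (FGj j)).
    move=> p [q [Fp -> <-]] /=; rewrite lerBlDr addrC lerD2l -lee_fin -Fp -F_C.
    apply: ge0_le_integral => //.
    - by move=> w _; rewrite lee_fin.
    - exact/measurable_EFinP.
    - exact/measurable_EFinP.
    - by move=> w _; rewrite lee_fin /Fj ge_min lexx.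
  case: (\int[Q]_m (phi j m)%:E)%E phi_int0 => [a| |]//= _; last by rewrite ltry.
  by rewrite lte_fin => /lt_le_trans; apply; rewrite ltrBlDr ltrDl ltr01.
have /choice[s sP] : forall j, exists h : {nnsfun config X >-> R},
    (forall m, (h m)%:E <= (phi j m)%:E)%E /\
    ((j%:R - C - 1)%:E < \int[Q]_m (h m)%:E)%E.
  by move=> j; exact: nnsfun_below.
pose Abar j m := (j%:R - s j m).
have mAbar j : measurable_fun setT (Abar j) by exact: measurable_funB.
have A_le j m : (\int[muN]_y (Fj j (mark m y))%:E <= (Abar j m)%:E)%E.
  have [] := fin_num_summands (int0 _ _ muN _ (fun y => Fj0 j (mark m y)))
    (int0 _ _ muN _ (fun y => Gj0 j (mark m y))) (FGm j m).
  move=> p [q [-> Gq pq]]; rewrite lee_fin /Abar -pq lerBrDr lerD2l -lee_fin.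
  by rewrite -Gq -phiE; exact: (sP j).1.
have Abar0 j m : 0 <= Abar j m.
  by rewrite -lee_fin (le_trans _ (A_le j m))// int0.
have Abar_int j : (\int[Q]_m (Abar j m)%:E <= (C + 1)%:E)%E.
  have ms : measurable_fun setT (s j : config X -> R) by [].
  have s0 m : 0 <= s j m by exact: fun_ge0.
  have [] := fin_num_summands (int0 _ _ Q _ (Abar0 j)) (int0 _ _ Q _ s0)
    (sum_j _ _ Q _ _ j (mAbar j) ms (Abar0 j) s0 (fun m => subrK _ _)).
  move=> p [q [-> sq pq]]; have := (sP j).2; rewrite sq lte_fin -pq lee_fin.
  by move=> h; lra.
(* Fatou's lemma over Q bounds the majorants; a second application, over the
   marks, will bound F by its truncations. *)
have fatouQ := @fatou _ _ _ Q setT measurableT (fun j m => (Abar j m)%:E)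
  (fun j => (measurable_EFinP _ _).2 (mAbar j))
  (fun j m _ => Abar0 j m).
pose L m := limn_einf (fun j => (Abar j m)%:E).
have limn_einf_cst (r : R) : limn_einf (fun=> r%:E) = r%:E.
  by have [] := cvg_limn_einf_sup (@cvg_cst _ r%:E nat \oo _).
have L0 m : (0 <= L m)%E.
  apply: (@le_trans _ _ (limn_einf (fun=> 0%:E))); first by rewrite limn_einf_cst.
  by apply: le_limn_einf => j; rewrite lee_fin.
have L_int : Q.-integrable setT L.
  apply/integrableP; split.
    apply: (emeasurable_fun_cvg (fun j m => einfs (fun i => (Abar i m)%:E) j)).
      by apply: measurable_fun_einfs => j; exact/measurable_EFinP.
    by move=> m _; rewrite /L limn_einf_lim; exact: is_cvg_einfs.
  under eq_integral do rewrite gee0_abs//.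
  apply: (le_lt_trans fatouQ); apply: (@le_lt_trans _ _ (C + 1)%:E).
    by rewrite -limn_einf_cst; exact: le_limn_einf.
  exact: ltry.
have := integrable_ae measurableT L_int; apply: filterS => m /(_ I).
rewrite fin_numElt => /andP[_]; apply: le_lt_trans.
apply: (@le_trans _ _ (limn_einf (fun j => \int[muN]_y (Fj j (mark m y))%:E)%E)).
  have limF w : limn_einf (fun j => (Fj j w)%:E) = (F w)%:E.
    suff /cvg_limn_einf_sup[] : (Fj j w)%:E @[j --> \oo] --> (F w)%:E by [].
    apply: cvg_near_cst; near=> j; congr EFin; apply/min_idPl.
    by near: j; exact: nbhs_infty_ger.
  under eq_integral do rewrite -limF.
  apply: fatou => //.
  - move=> j; apply/measurable_EFinP.
    exact: (measurableT_comp (mFj j) (measurable_mark m)).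
  - by move=> j y _; rewrite lee_fin.
exact: le_limn_einf.
Unshelve. all: by end_near.
Qed.

End marked_law.

(** * Positive semidefinite matrices almost everywhere *)

Section almost_everywhere_countable.
Context d (T : measurableType d) (R : realType).
Variable nu : {measure set T -> \bar R}.

Lemma ae_forall_count (I : countType) (A : I -> T -> Prop) :
  (forall i, {ae nu, forall t, A i t}) -> {ae nu, forall t, forall i, A i t}.
Proof.
move=> Aae.
have : {ae nu, forall t, forall n,
    if @choice.unpickle I n is Some i then A i t else True}.
  apply: ae_foralln => n; case: (choice.unpickle n) => [i|]; first exact: Aae.
  exact: aeW.
by apply: filterS => t At i; have := At (choice.pickle i); rewrite choice.pickleK.
Qed.

Lemma ae_forall_points (X : Type) (m : config X) (A : X -> T -> Prop) :
  (forall x, points m x -> {ae nu, forall t, A x t}) ->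
  {ae nu, forall t, forall x, points m x -> A x t}.
Proof.
move=> Aae.
have : {ae nu, forall t, forall n, forall x,
    points m x -> numbering m x = n -> A x t}.
  apply: ae_foralln => n.
  have [[x [mx xn]]|nox] := pselect (exists x, points m x /\ numbering m x = n).
    apply: filterS (Aae x mx) => t At x' mx' x'n.
    by rewrite (@numbering_inj _ m x' x) ?inE// x'n.
  by apply: aeW => t x mx xn; case: nox; exists x.
by apply: filterS => t At x mx; exact: At.
Qed.

End almost_everywhere_countable.

Section positive_semidefinite.
Context (R : realType) (n : nat).

(** Testing positivity on rational vectors only leaves countably many
    conditions, which may hold simultaneously almost everywhere. *)
Definition rat_psd (A : 'M[R]_n) : Prop := forall v : {ffun 'I_n -> rat},
  0 <= \sum_i \sum_j ratr (v i) * A i j * ratr (v j).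

Lemma rat_psd_real (A : 'M[R]_n) (v : 'I_n -> R) : rat_psd A ->
  0 <= \sum_i \sum_j v i * A i j * v j.
Proof.
move=> psdA.
have /choice[q qP] : forall p : nat * 'I_n, exists q : rat,
    `|v p.2 - ratr q| < p.1.+1%:R^-1.
  move=> [N i] /=.
  have : v i - N.+1%:R^-1 < v i + N.+1%:R^-1 by rewrite ltrD2l gtrN// invr_gt0.
  move=> /rat_in_itvoo[q]; rewrite in_itv/= => /andP[q1 q2]; exists q.
  by rewrite ltr_distlC q1 q2.
have cvg_q i : (ratr (q (N, i)) : R) @[N --> \oo] --> v i.
  apply/cvgrPdist_lt => e e0; near=> N.
  apply: lt_trans (qP (N, i)) _ => /=.
  by near: N; exact: near_infty_natSinv_lt (PosNum e0).
have : (\sum_i \sum_j ratr (q (N, i)) * A i j * ratr (q (N, j)) : R)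
    @[N --> \oo] --> \sum_i \sum_j v i * A i j * v j.
  apply: cvg_big => [|i _]; first exact: add_continuous.
  apply: cvg_big => [|j _]; first exact: add_continuous.
  by apply: cvgM => //; apply: cvgM => //; exact: cvg_cst.
move=> cvgS; rewrite -(cvg_lim (@Rhausdorff R) cvgS).
apply: limr_ge; first by apply/cvg_ex; eexists; exact: cvgS.
apply: nearW => N; have := psdA [ffun i => q (N, i)].
by congr (_ <= _); apply: eq_bigr => i _; apply: eq_bigr => j _; rewrite !ffunE.
Unshelve. all: by end_near. Qed.

(** Deform [A] linearly into the identity: all the intermediate matrices are
    definite, hence nonsingular, so that the determinant cannot change sign. *)
Lemma det_psd_ge0 (A : 'M[R]_n) : rat_psd A -> 0 <= \det A.
Proof.
move=> psdA; rewrite leNgt; apply/negP => detA.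
(* The determinant of (1 - s) A + s, as a polynomial in s; it is negative at 0 and
   equal to 1 at 1. *)
pose B : 'M[{poly R}]_n := map_mx polyC A + 'X *: map_mx polyC (1%:M - A).
have detB s : (\det B).[s] = \det (A + s *: (1%:M - A)).
  rewrite -horner_evalE -det_map_mx; congr (\det _).
  by apply/matrixP => i j; rewrite !mxE /= horner_evalE !hornerE.
have : (\det B).[0] <= 0 <= (\det B).[1].
  rewrite !detB scale0r addr0 (ltW detA) scale1r addrC subrK det1.
  exact: ler01.
move=> /(poly_ivt ler01)[s /andP[s0 s1] /rootP]; rewrite detB => detAs.
have {}s0 : 0 < s.
  rewrite lt_neqAle s0 andbT; apply/eqP => s00.
  by move: detA; rewrite -detAs -s00 scale0r addr0 ltxx.
have /det0P[v v0 vA] : \det (A + s *: (1%:M - A)) == 0 by apply/eqP.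
have quad (M : 'M[R]_n) : (v *m M *m v^T) 0 0 =
    \sum_i \sum_j v 0 i * M i j * v 0 j.
  rewrite mxE exchange_big/=; apply: eq_bigr => j _.
  by rewrite !mxE big_distrl.
have E : (1 - s) * (v *m A *m v^T) 0 0 + s * (v *m v^T) 0 0 = 0.
  have := congr1 (fun u : 'rV_n => (u *m v^T) 0 0) vA.
  have -> : A + s *: (1%:M - A) = (1 - s) *: A + s *: 1%:M.
    by rewrite scalerBr scalerBl scale1r addrA addrAC.
  rewrite /= mul0mx [RHS]mxE mulmxDr mulmxDl -!scalemxAr -!scalemxAl mulmx1.
  by move=> <-; rewrite !mxE.
move: E; rewrite quad; have := rat_psd_real (v 0) psdA.
set a := \sum_i _ => a0.
have : 0 < (v *m v^T) 0 0.
  rewrite mxE lt_def sumr_ge0 ?andbT; last first.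
    by move=> i _; rewrite mxE -expr2 sqr_ge0.
  apply: contra_neqN v0; rewrite psumr_eq0; last first.
    by move=> i _; rewrite mxE -expr2 sqr_ge0.
  move=> /allP v0; apply/rowP => i; rewrite mxE.
  by have := v0 i (mem_index_enum _); rewrite mxE -expr2 sqrf_eq0 => /eqP.
move=> b0; move: (mulr_gt0 s0 b0); set b := s * _.
have : 0 <= (1 - s) * a by rewrite mulr_ge0// subr_ge0.
by set c := (1 - s) * a; lra.
Qed.

End positive_semidefinite.

(** * Bilinearity of the carre du champ *)

Section carre_du_champ.
Context d (Y : measurableType d) (R : realType).
Variable mu : {measure set Y -> \bar R}.
Variables (dom : set (Y -> R)) (gamma : (Y -> R) -> (Y -> R) -> Y -> R).
Hypothesis structure : local_dirichlet_structure mu dom gamma.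

Lemma dom_add f g : dom f -> dom g -> dom (f \+ g).
Proof.
move=> df dg; have := dirichlet_linear structure 1 df dg.
by congr dom; apply/funext => x; rewrite /= mul1r.
Qed.

Lemma dom_sub f g : dom f -> dom g -> dom (f \- g).
Proof.
move=> df dg; have := dirichlet_linear structure (-1) dg df.
by congr dom; apply/funext => x; rewrite /= mulN1r addrC.
Qed.

Lemma gamma_add f g h : dom f -> dom g -> dom h ->
  {ae mu, forall u, gamma (f \+ g) h u = gamma f h u + gamma g h u}.
Proof.
move=> df dg dh; have := gamma_linear structure 1 df dg dh.
have -> : (fun x => 1 * f x + g x) = f \+ g.
  by apply/funext => x; rewrite mul1r.
by apply: filterS => u /(_ I) ->; rewrite mul1r.
Qed.

Lemma gamma_sub f g h : dom f -> dom g -> dom h ->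
  {ae mu, forall u, gamma (f \- g) h u = gamma f h u - gamma g h u}.
Proof.
move=> df dg dh; have := gamma_linear structure (-1) dg df dh.
have -> : (fun x => -1 * g x + f x) = f \- g.
  by apply/funext => x; rewrite mulN1r addrC.
by apply: filterS => u /(_ I) ->; rewrite mulN1r addrC.
Qed.

Lemma gamma_polarization f g : dom f -> dom g ->
  {ae mu, forall u, (gamma (f \+ g) (f \+ g) u - gamma (f \- g) (f \- g) u) / 4 =
    gamma f g u}.
Proof.
move=> df dg; have dp := dom_add df dg; have dm := dom_sub df dg.
have p1 := gamma_add df dg dp; have m1 := gamma_sub df dg dm.
have p2 := gamma_sym structure df dp; have p3 := gamma_sym structure dg dp.
have m2 := gamma_sym structure df dm; have m3 := gamma_sym structure dg dm.
have p4 := gamma_add df dg df; have p5 := gamma_add df dg dg.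
have m4 := gamma_sub df dg df; have m5 := gamma_sub df dg dg.
have s := gamma_sym structure df dg.
near=> u.
have -> : gamma (f \+ g) (f \+ g) u = gamma f (f \+ g) u + gamma g (f \+ g) u.
  by near: u.
have -> : gamma (f \- g) (f \- g) u = gamma f (f \- g) u - gamma g (f \- g) u.
  by near: u.
have -> : gamma f (f \+ g) u = gamma (f \+ g) f u by move: I; near: u.
have -> : gamma g (f \+ g) u = gamma (f \+ g) g u by move: I; near: u.
have -> : gamma f (f \- g) u = gamma (f \- g) f u by move: I; near: u.
have -> : gamma g (f \- g) u = gamma (f \- g) g u by move: I; near: u.
have -> : gamma (f \+ g) f u = gamma f f u + gamma g f u by near: u.
have -> : gamma (f \+ g) g u = gamma f g u + gamma g g u by near: u.
have -> : gamma (f \- g) f u = gamma f f u - gamma g f u by near: u.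
have -> : gamma (f \- g) g u = gamma f g u - gamma g g u by near: u.
have -> : gamma f g u = gamma g f u by move: I; near: u.
by lra.
Unshelve. all: by end_near. Qed.

Section linear_combinations.
Variables (I : Type) (a : I -> R) (f : I -> Y -> R).
Hypothesis df : forall i, dom (f i).

Let lincomb s : Y -> R := fun x => \sum_(i <- s) a i * f i x.

Let lincomb_cons i s : lincomb (i :: s) = fun x => a i * f i x + lincomb s x.
Proof. by apply/funext => x; rewrite /lincomb big_cons. Qed.

Let lincomb_nil g : lincomb [::] = fun x => -1 * g x + g x.
Proof. by apply/funext => x; rewrite /lincomb big_nil mulN1r addNr. Qed.

Lemma dom_lincomb s g : dom g -> dom (fun x => \sum_(i <- s) a i * f i x).
Proof.
move=> dg; rewrite -/(lincomb s); elim: s => [|i s IHs].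
  by rewrite (lincomb_nil g); exact: (dirichlet_linear structure).
by rewrite lincomb_cons; exact: (dirichlet_linear structure).
Qed.

Lemma gamma_lincomb s g : dom g ->
  {ae mu, forall u, gamma (fun x => \sum_(i <- s) a i * f i x) g u =
    \sum_(i <- s) a i * gamma (f i) g u}.
Proof.
move=> dg; rewrite -/(lincomb s); elim: s => [|i s IHs].
  rewrite (lincomb_nil g).
  have := gamma_linear structure (-1) dg dg dg.
  by apply: filterS => u /(_ Logic.I) ->; rewrite big_nil mulN1r addNr.
have := gamma_linear structure (a i) (df i) (dom_lincomb s dg) dg.
rewrite lincomb_cons; apply: filterS2 IHs => u IHu /(_ Logic.I) ->.
by rewrite -/(lincomb s) IHu big_cons.
Qed.

End linear_combinations.

(** By polarization the entries are gamma[f_i, f_j], and the quadratic form of this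
    matrix at v is gamma[F] >= 0 for F = sum_i v_i f_i.  The exceptional null set
    depends on v, whence the restriction to rational v. *)
Lemma gamma_rat_psd k (f : 'I_k -> Y -> R) : (0 < k)%N ->
  (forall i, dom (f i)) ->
  {ae mu, forall u, rat_psd (\matrix_(i, j)
    ((gamma (f i \+ f j) (f i \+ f j) u - gamma (f i \- f j) (f i \- f j) u) / 4))}.
Proof.
move=> k0 df; have d0 := df (Ordinal k0).
apply: ae_forall_count => v.
pose a i : R := ratr (v i).
pose F x := \sum_(i < k) a i * f i x.
have dF : dom F by exact: (dom_lincomb _ _ _ d0).
have F0 := gamma_ge0 structure dF.
have FF := gamma_lincomb a df (index_enum _) dF.
have Fs : {ae mu, forall u, forall i, gamma (f i) F u = gamma F (f i) u}.
  apply: ae_forall_count => i.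
  by have := gamma_sym structure (df i) dF; apply: filterS => u /(_ I).
have Ff : {ae mu, forall u, forall i, gamma F (f i) u =
    \sum_j a j * gamma (f j) (f i) u}.
  by apply: ae_forall_count => i; exact: gamma_lincomb.
have pol : {ae mu, forall u, forall p : 'I_k * 'I_k,
    (gamma (f p.1 \+ f p.2) (f p.1 \+ f p.2) u -
     gamma (f p.1 \- f p.2) (f p.1 \- f p.2) u) / 4 = gamma (f p.1) (f p.2) u}.
  by apply: ae_forall_count => p; exact: gamma_polarization.
apply: filterS (filterI (filterI F0 FF) (filterI Fs (filterI Ff pol))).
move=> u [[F0u FFu] [Fsu [Ffu polu]]].
suff -> : \sum_i \sum_j ratr (v i) * (\matrix_(i, j)
    ((gamma (f i \+ f j) (f i \+ f j) u - gamma (f i \- f j) (f i \- f j) u) / 4))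
    i j * ratr (v j) = gamma F F u by [].
rewrite FFu exchange_big/=; apply: eq_bigr => j _.
rewrite Fsu Ffu mulr_sumr; apply: eq_bigr => i _; rewrite mxE (polu (i, j)).
by rewrite mulrC /a mulrA.
Qed.

End carre_du_champ.

(** * The carre du champ through insertion and deletion of points *)

(** [numbering m] may skip integers: sums over the points of [m] become series
    restricted to the integers which are actually used. *)
Section enumeration.
Context (X : pointedType) (m : config X).

Definition is_number (i : nat) : bool :=
  `[< exists x, points m x /\ numbering m x = i >].

Definition point_of (i : nat) : X :=
  xget point [set x | points m x /\ numbering m x = i].

Lemma point_ofP i : is_number i ->
  points m (point_of i) /\ numbering m (point_of i) = i.
Proof.
move=> /asboolP[x mx]; rewrite /point_of; case: xgetP => [y -> //|].
by move=> /(_ x).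
Qed.

Lemma is_number_numbering x : points m x -> is_number (numbering m x).
Proof. by move=> mx; apply/asboolP; exists x. Qed.

Lemma point_of_numbering x : points m x -> point_of (numbering m x) = x.
Proof.
move=> mx; have [my E] := point_ofP (is_number_numbering mx).
by apply: (@numbering_inj _ m); rewrite ?inE.
Qed.

Lemma point_of_bij : set_bij [set i | is_number i] m point_of.
Proof.
split => [i /= /point_ofP[]//|i j|x mx].
  by rewrite !inE => /point_ofP[_ iE] /point_ofP[_ jE] ij; rewrite -iE -jE ij.
exists (numbering m x); last exact: point_of_numbering.
exact: is_number_numbering.
Qed.

Lemma esum_points (R : realType) (a : X -> \bar R) :
  (forall x, points m x -> 0 <= a x)%E ->
  (\esum_(x in m) a x = \sum_(i <oo | is_number i) a (point_of i))%E.
Proof.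
move=> a0; rewrite (reindex_esum _ _ _ a point_of_bij) nneseries_esum//.
by move=> i /point_ofP[mi _]; exact: a0.
Qed.

Context d (T : measurableType d).

Lemma measurable_forall_points (A : X -> set T) :
  (forall x, points m x -> measurable (A x)) ->
  measurable [set t | forall x, points m x -> A x t].
Proof.
move=> mA; rewrite (_ : [set _ | _] =
    \bigcap_(i in [set i | is_number i]) A (point_of i)).
  by apply: bigcap_measurableType => i /point_ofP[mi _]; exact: mA.
apply/seteqP; split => t /= At.
  by move=> i /point_ofP[mi _]; exact: At.
by move=> x mx; have := At _ (is_number_numbering mx); rewrite point_of_numbering.
Qed.

Lemma measurable_esum_points (R : realType) (a : X -> T -> \bar R) :
  (forall x t, points m x -> 0 <= a x t)%E ->
  (forall x, points m x -> measurable_fun setT (a x)) ->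
  measurable_fun setT (fun t => \esum_(x in m) a x t)%E.
Proof.
move=> a0 ma; rewrite (_ : (fun t => _) =
    fun t => (\sum_(i <oo | i \in is_number) a (point_of i) t)%E); last first.
  by apply/funext => t; rewrite esum_points// => x mx; exact: a0.
apply: (@ge0_emeasurable_sum _ _ _ setT (fun i t => a (point_of i) t) is_number).
  by move=> i t _ /point_ofP[mi _]; exact: a0.
by move=> i /point_ofP[mi _]; exact: ma.
Qed.

End enumeration.

Section upper_structure.
Context (R : realType) (dX dY : measure_display).
Context (X : measurableType dX) (Y : measurableType dY).
Variables (Q : probability (config X) R) (mu : probability Y R).
Variables (dom : set (Y -> R)) (gamma : (Y -> R) -> (Y -> R) -> Y -> R).
Hypothesis structure : local_dirichlet_structure mu dom gamma.
Variables (muN : probability (markseq Y) R).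
Hypothesis muN_prod : is_infinite_product mu muN.
Variables (P : probability (config (X * Y)) R).
Hypothesis P_law : is_marked_law Q muN P.

Definition sections_in_dom (F : config (X * Y) -> R) : Prop :=
  {ae Q, forall m : config X, forall x, points m x ->
    {ae muN, forall y : markseq Y, dom (mark_section F m y x)}}.

(** Nonnegativity of gamma holds for almost every value of the resampled mark, and
    is transferred to the marks themselves by [ae_of_resample]. *)
Lemma upper_gamma_i_ge0 F g : sections_in_dom F ->
  upper_gamma_i Q mu muN gamma F g ->
  {ae Q, forall m, {ae muN, forall y, forall x, points m x -> 0 <= g (mark m y) x}}.
Proof.
move=> domF gF; apply: filterS2 domF gF => m domFm gFm.
apply: ae_forall_points => x mx; have [mg gx] := gFm x mx.
apply: (@ae_of_resample _ _ _ mu muN muN_prod (numbering m x)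
  [set y | 0 <= g (mark m y) x]).
  by rewrite -[[set _ | _]]setTI; exact: measurable_fun_le.
apply: filterS2 (domFm x mx) gx => y dy gy.
by apply: filterS2 (gamma_ge0 structure dy) gy => u g0 gu /=; rewrite gu.
Qed.

Lemma esum_mark_fst (a : X -> \bar R) m (y : markseq Y) :
  (\esum_(z in mark m y) a z.1 = \esum_(x in m) a x)%E.
Proof. by rewrite (esum_mark _ _ (a \o fst)). Qed.

(** Construction of a version of gamma[eps^+ F] whose integral with respect to N is
    measurable, although the given version [g] of the gamma_i is arbitrary on a
    null set of configurations which need not even be measurable. *)
Section version.
Variables (F h : config (X * Y) -> R) (g : config (X * Y) -> X -> R).
Hypothesis mh : measurable_fun setT h.

Definition regular (w : config (X * Y)) : Prop :=
  (forall z, points w z -> 0 <= g w z.1) /\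
  (\esum_(z in w) (g w z.1)%:E = (h w)%:E)%E.

(** The point [base w] receives the whole mass of an irregular configuration [w].
    Its first component depends on the projection of [w] on X only, so that for
    [w = mark m y] it does not depend on [y]: otherwise measurability in [y] of the
    version would be lost. *)
Definition base_x (w : config (X * Y)) : X := xget point [set z.1 | z in points w].

Definition base (w : config (X * Y)) : X * Y :=
  (base_x w, xget point [set u | points w (base_x w, u)]).

Definition gamma_at (w : config (X * Y)) (x : X) (u : Y) : R :=
  if `[< regular w >] then g w x
  else if (x, u) == base w then Num.max (h w) 0 else 0.

Definition gamma_epsp_version (w : config (X * Y)) (x : X) (u : Y) : R :=
  gamma_at (eps_plus w (x, u)) x u.

Lemma epsm_version w x u : points w (x, u) ->
  epsm gamma_epsp_version w x u = gamma_at w x u.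
Proof.
by move=> wxu; rewrite /epsm /gamma_epsp_version eps_plus_minus_id.
Qed.

Lemma base_in (w : config (X * Y)) : (w : set _) !=set0 -> points w (base w).
Proof.
move=> [[x u] wxu]; rewrite /base.
have : [set z.1 | z in points w] (base_x w).
  by rewrite /base_x; case: xgetP => [? -> //|/(_ x)[]]; exists (x, u).
move=> [[x' u'] /= wz <-].
by case: xgetP => [? -> //|/(_ u')].
Qed.

Lemma base_mark (m : config X) (y : markseq Y) : (m : set _) !=set0 ->
  base (mark m y) = (xget point (points m), y (numbering m (xget point (points m)))).
Proof.
move=> [x mx].
have := @base_in (mark m y)
  (ex_intro _ (x, y (numbering m x)) (ex_intro2 _ _ x mx erefl)).
have bx : base_x (mark m y) = xget point (points m).
  rewrite /base_x; congr (xget _ _); apply/seteqP; split => x'.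
    by move=> [_ [x1 mx1 <-] <-].
  by move=> mx'; exists (x', y (numbering m x')) => //; exists x'.
rewrite /base bx => -[x1 mx1 [<- <-]].
by [].
Qed.

(** On a regular configuration the sum is [h w], which is then nonnegative; the
    mass put on the base point of an irregular one is chosen to give the same
    formula. *)
Lemma integral_gamma_at (w : config (X * Y)) :
  integral_N (epsm gamma_epsp_version) w =
  (if (w : set _) == set0 then 0 else Num.max (h w) 0)%:E.
Proof.
rewrite /integral_N (eq_esum (b := fun z => (gamma_at w z.1 z.2)%:E)); last first.
  by move=> [x u] wz; rewrite epsm_version.
case: eqP => [->|/eqP/set0P w0]; first by rewrite esum_set0.
rewrite /gamma_at; case: asboolP => [[g0 gh]|_].
  rewrite gh; congr EFin; apply/esym/max_idPl; rewrite -lee_fin -gh.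
  by apply: esum_ge0 => z wz; rewrite lee_fin g0.
have wb := base_in w0.
transitivity (\esum_(z in (w : set _) `&` [set base w]) (Num.max (h w) 0)%:E)%E.
  rewrite esum_mkcondr; apply: eq_esum => -[x u] wz /=.
  by case: eqP => [->|xu]; [rewrite mem_set|rewrite memNset].
have -> : (w : set _) `&` [set base w] = [set base w].
  by apply/setIidPr => z ->.
by rewrite esum_set1// lee_fin le_max lexx orbT.
Qed.


Lemma measurable_empty : measurable [set w : config (X * Y) | (w : set _) == set0].
Proof.
apply: sub_sigma_algebra; exists setT, 0%N; split => //.
apply/seteqP; split => w /=.
  by move=> /eqP ->; rewrite set0I II0.
by rewrite setIT II0 card_eq0.
Qed.

Lemma measurable_integral_gamma_at :
  measurable_fun setT (integral_N (epsm gamma_epsp_version)).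
Proof.
rewrite (_ : integral_N _ =
  fun w => (if (w : set _) == set0 then 0 else Num.max (h w) 0)%:E); last first.
  by apply/funext => w; exact: integral_gamma_at.
apply/measurable_EFinP; apply: measurable_fun_ifT => //.
  apply: (measurable_fun_bool true); rewrite setTI; exact: measurable_empty.
exact: measurable_maxr.
Qed.

Lemma regular_mark (m : config X) (y : markseq Y) : regular (mark m y) <->
  (forall x, points m x -> 0 <= g (mark m y) x) /\
  (h (mark m y))%:E = (\esum_(x in m) (g (mark m y) x)%:E)%E.
Proof.
rewrite /regular (esum_mark_fst (fun x => (g (mark m y) x)%:E)).
split => -[g0 gh]; split => //.
  by move=> x mx; apply: (g0 (x, y (numbering m x))); exists x.
by move=> _ [x mx <-]; exact: g0.
Qed.

Lemma measurable_regular (m : config X) :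
  (forall x, points m x -> measurable_fun setT (fun y => g (mark m y) x)) ->
  measurable [set y | regular (mark m y)].
Proof.
move=> mg; rewrite (_ : [set _ | _] =
    [set y | forall x, points m x -> 0 <= g (mark m y) x] `&`
    [set y | (h (mark m y))%:E =
       (\esum_(x in m) (Num.max (g (mark m y) x) 0)%:E)%E]).
  apply: measurableI.
    apply: (@measurable_forall_points _ m _ _
      (fun x => [set y | 0 <= g (mark m y) x])) => x mx.
    rewrite -[[set _ | _]]setTI.
    by apply: measurable_fun_le => //; exact: mg.
  rewrite -[[set _ | _]]setTI; apply: measurable_eqe => //.
    apply/measurable_EFinP; exact: (measurableT_comp mh (measurable_mark m)).
  apply: (measurable_esum_points (a := fun x y => (Num.max (g (mark m y) x) 0)%:E)).
    by move=> x y mx; rewrite lee_fin le_max lexx orbT.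
  move=> x mx; apply/measurable_EFinP; apply: measurable_maxr => //; exact: mg.
apply/seteqP; split => y /=.
  move=> /regular_mark[g0 gh]; split => //; rewrite gh.
  by apply: eq_esum => x mx; congr EFin; apply/esym/max_idPl/g0.
move=> [g0 gh]; apply/regular_mark; split => //; rewrite gh.
by apply: eq_esum => x mx; congr EFin; apply/max_idPl/g0.
Qed.

Hypotheses (domF : sections_in_dom F) (gF : upper_gamma_i Q mu muN gamma F g).
Hypothesis hg : {ae Q, forall m : config X, {ae muN, forall y : markseq Y,
  (h (mark m y))%:E = (\esum_(x in m) (g (mark m y) x)%:E)%E}}.

Lemma ae_regular : {ae Q, forall m, {ae muN, forall y, regular (mark m y)}}.
Proof.
apply: filterS2 (upper_gamma_i_ge0 domF gF) hg => m g0 hm.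
by apply: filterS2 g0 hm => y g0y hy; apply/regular_mark.
Qed.

Lemma gamma_epsp_versionP : gamma_epsp Q mu muN gamma F gamma_epsp_version.
Proof.
split; first exact: measurable_integral_gamma_at.
apply: filterS2 gF ae_regular => m gFm regm x mx.
have [mgx gx] := gFm x mx.
have mark_in y : points (mark m y) (x, y (numbering m x)) by exists x.
split.
  under eq_fun do rewrite epsm_version// /gamma_at.
  apply: measurable_fun_ifT.
  - apply: (measurable_fun_bool true); rewrite setTI.
    rewrite (_ : _ @^-1` _ = [set y | regular (mark m y)]).
      by apply: measurable_regular => x' mx'; have [] := gFm x' mx'.
    by apply/seteqP; split => y /asboolP.
  - exact: mgx.
  - apply: measurable_fun_ifT.
    + rewrite (_ : (fun y => _) = fun=> x == xget point (points m)).
        exact: measurable_cst.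
      apply/funext => y; rewrite base_mark; last by exists x.
      apply/eqP/eqP => [[]//|xE].
      by rewrite {1}xE {1}xE.
    + apply: measurable_maxr => //.
      exact: (measurableT_comp mh (measurable_mark m)).
    + exact: measurable_cst.
apply: filterS2 gx (ae_resample muN_prod (numbering m x) regm) => y gy regy.
apply: filterS2 gy regy => u gu regu.
have -> : epsp F (eps_minus (mark m y) (x, y (numbering m x))) x =
    mark_section F m y x.
  by apply/funext => u'; rewrite /epsp eps_plus_minus_mark.
rewrite /gamma_epsp_version eps_plus_minus_mark// /gamma_at.
by rewrite asboolT.
Qed.

(** At [set_mark y k u] both sides are gamma of the same section, evaluated at
    [u]. *)
Lemma epsm_gamma H : gamma_epsp Q mu muN gamma F H ->
  {ae Q, forall m, {ae muN, forall y, forall x, points m x ->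
    epsm H (mark m y) x (y (numbering m x)) = g (mark m y) x}}.
Proof.
move=> [_ HF]; apply: filterS2 gF HF => m gFm HFm.
apply: ae_forall_points => x mx.
have [mgx gx] := gFm x mx; have [mHx Hx] := HFm x mx.
apply: (@ae_of_resample _ _ _ mu muN muN_prod (numbering m x)
  [set y | epsm H (mark m y) x (y (numbering m x)) = g (mark m y) x]).
  rewrite -[[set _ | _]]setTI.
  rewrite (_ : [set _ | _] = [set y |
    (epsm H (mark m y) x (y (numbering m x)))%:E = (g (mark m y) x)%:E]).
    by apply: measurable_eqe => //; exact/measurable_EFinP.
  by apply/seteqP; split => y /= [->].
apply: filterS2 gx Hx => y gy Hy; apply: filterS2 gy Hy => u gu Hu /=.
rewrite set_markE eqxx gu /epsm eps_minus_set_mark// Hu.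
have -> // : epsp F (eps_minus (mark m y) (x, y (numbering m x))) x =
    mark_section F m y x.
by apply/funext => u'; rewrite /epsp eps_plus_minus_mark.
Qed.

Lemma upper_gamma_epsp H : gamma_epsp Q mu muN gamma F H ->
  {ae P, forall w, (h w)%:E = integral_N (epsm H) w}.
Proof.
move=> HF; apply: (ae_marked P_law (A := [set w | (h w)%:E = integral_N (epsm H) w])).
  rewrite -[[set _ | _]]setTI; apply: measurable_eqe => //; last by case: HF.
  exact/measurable_EFinP.
apply: filterS2 (epsm_gamma HF) hg => m Hm hm.
apply: filterS2 Hm hm => y Hy hy /=.
rewrite hy /integral_N esum_mark; apply: eq_esum => x mx /=.
by rewrite Hy.
Qed.

End version.
End upper_structure.

(** * Determinants, and integrals that vanish *)

Section determinant_of_functions.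
Context (R : realType) (k : nat).

Lemma measurable_det d (T : measurableType d) (A : T -> 'M[R]_k) :
  (forall i j, measurable_fun setT (fun t => A t i j)) ->
  measurable_fun setT (fun t => \det (A t)).
Proof.
move=> mA; rewrite /determinant; apply: measurable_sum => s.
apply: measurable_funM => //; apply: measurable_prod => i _; exact: mA.
Qed.

Lemma cvg_det (A : nat -> 'M[R]_k) (B : 'M[R]_k) :
  (forall i j, A N i j @[N --> \oo] --> B i j) ->
  \det (A N) @[N --> \oo] --> \det B.
Proof.
move=> AB; rewrite /determinant.
apply: cvg_big => [|s _]; first exact: add_continuous.
apply: cvgM; first exact: cvg_cst.
by apply: cvg_big => [|i _]; first exact: mul_continuous.
Qed.

Lemma rat_psd_sum I (s : seq I) (p : pred I) (A : I -> 'M[R]_k) :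
  (forall i, p i -> rat_psd (A i)) -> rat_psd (\sum_(i <- s | p i) A i).
Proof.
move=> psdA; elim/big_ind : _ => //.
  by move=> v; rewrite sumr_ge0// => i _; rewrite sumr_ge0// => j _;
    rewrite mxE mulr0 mul0r.
move=> B C psdB psdC v; have := addr_ge0 (psdB v) (psdC v).
rewrite -big_split; congr (_ <= _); apply: eq_bigr => i _.
by rewrite -big_split; apply: eq_bigr => j _; rewrite mxE mulrDr mulrDl.
Qed.

End determinant_of_functions.

Lemma measurable_imply d (T : measurableType d) (A C : set T) :
  measurable A -> measurable C -> measurable [set t | A t -> C t].
Proof.
move=> mA mC; rewrite (_ : [set _ | _] = ~` A `|` C).
  by apply: measurableU => //; exact: measurableC.
apply/seteqP; split => t /=; last by move=> [].
by move=> AC; have [/AC|] := pselect (A t); [right|left].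
Qed.

Lemma measurable_mktuple (R : realType) d (T : measurableType d) k
    (U : 'I_k -> T -> R) : (forall i, measurable_fun setT (U i)) ->
  measurable_fun setT
    (fun t => [tuple U i t | i < k] : k.-tuple (measurableTypeR R)).
Proof.
move=> mU; apply/measurable_fun_tnthP => i.
rewrite (_ : _ \o _ = U i); first exact: mU.
by apply/funext => t /=; rewrite tnth_mktuple.
Qed.

Section integrability.
Context d (T : measurableType d) (R : realType).
Variable nu : {measure set T -> \bar R}.

Lemma Lfun2_sqr (f : T -> R) : measurable_fun setT f ->
  (\int[nu]_t (f t ^+ 2)%:E < +oo)%E -> f \in Lfun nu 2%:E.
Proof.
move=> mf foo; rewrite inE; apply/andP; split; first by rewrite inE.
rewrite inE /= /finite_norm unlock; apply: poweR_lty.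
rewrite (eq_integral (fun t => (f t ^+ 2)%:E))// => t _ /=.
by rewrite powR_mulrn// -normrX ger0_norm// sqr_ge0.
Qed.

(** As f may take negative values, it is its positive part that is compared
    with g. *)
Lemma integral_le_ae (f g : T -> R) : measurable_fun setT f ->
  measurable_fun setT g -> (forall t, 0 <= g t) ->
  {ae nu, forall t, f t <= g t} ->
  (\int[nu]_t (f t)%:E <= \int[nu]_t (g t)%:E)%E.
Proof.
move=> mf mg g0 fg; rewrite integralE.
apply: (@le_trans _ _ (\int[nu]_t ((EFin \o f)^\+ t))%E).
  by rewrite -[leRHS]sube0; apply: leeB => //; exact: integral_ge0.
apply: ae_ge0_le_integral => //.
- by apply: measurable_funepos; exact/measurable_EFinP.
- by move=> t _; rewrite lee_fin.
- exact/measurable_EFinP.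
apply: filterS fg => t fg _; rewrite funeposE /= -EFin_max.
by rewrite lee_fin ge_max fg g0.
Qed.

Lemma integral0_ae (D : set T) (f : T -> R) : measurable D ->
  measurable_fun setT f -> {ae nu, forall t, 0 <= f t} ->
  (\int[nu]_(t in D) (f t)%:E = 0)%E -> {ae nu, forall t, D t -> f t = 0}.
Proof.
move=> mD mf f0 int0.
have mfD : measurable_fun D (EFin \o f).
  by apply/measurable_EFinP; exact: measurable_funTS.
have : (\int[nu]_(t in D) `|(f t)%:E| = 0)%E.
  rewrite -int0; apply: ae_eq_integral => //; first exact: measurableT_comp.
  by apply: filterS f0 => t f0 _; rewrite gee0_abs.
move/(ae_eq_integral_abs _ mD mfD); apply: filterS => t /[apply] -[].
by [].
Qed.

End integrability.

(** * The first marks of a function of the upper domain *)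

Section first_points.
Context (X : pointedType) (m : config X) (N : nat).

(** Unused numbers have to be skipped: a function on the finite product would be
    constant in the corresponding marks, and constants need not belong to
    [dom]. *)
Definition numbers : seq nat := [seq i <- iota 0 N | is_number m i].

Lemma uniq_numbers : uniq numbers.
Proof. by rewrite filter_uniq// iota_uniq. Qed.

Definition nth_point (j : 'I_(size numbers)) : X := point_of m (nth 0%N numbers j).

Lemma nth_pointP j : points m (nth_point j) /\
  numbering m (nth_point j) = nth 0%N numbers j.
Proof.
apply: point_ofP; have := mem_nth 0%N (ltn_ord j).
by rewrite mem_filter => /andP[].
Qed.

Lemma sum_nth_point (V : nmodType) (a : X -> V) :
  \sum_j a (nth_point j) = \sum_(0 <= i < N | is_number m i) a (point_of m i).
Proof.
by rewrite -[RHS]big_filter /index_iota subn0 -/numbers (big_nth 0%N) big_mkord.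
Qed.

End first_points.

Section descent.
Context (R : realType) (dX dY : measure_display).
Context (X : measurableType dX) (Y : measurableType dY).
Variables (Q : probability (config X) R) (mu : probability Y R).
Variables (dom : set (Y -> R)) (gamma : (Y -> R) -> (Y -> R) -> Y -> R).
Hypothesis structure : local_dirichlet_structure mu dom gamma.
Variables (muN : probability (markseq Y) R).
Hypothesis muN_prod : is_infinite_product mu muN.
Variables (P : probability (config (X * Y)) R).
Hypothesis P_law : is_marked_law Q muN P.

Lemma upper_dom_measurable F : upper_dom Q mu muN P dom gamma F ->
  measurable_fun setT F.
Proof. by move=> [+ _ _]; rewrite inE => /andP[]; rewrite inE. Qed.

Definition first_marks (F : config (X * Y) -> R) (m : config X) N
    (y : markseq Y) (t : (size (numbers m N)).-tuple Y) : R :=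
  F (mark m (merge (numbers m N) t y)).

Lemma measurable_first_marks F m N y : measurable_fun setT F ->
  measurable_fun setT (@first_marks F m N y).
Proof.
move=> mF.
exact: (measurableT_comp (measurableT_comp mF (measurable_mark m))
  (@measurable_merge _ Y (size (numbers m N)) (numbers m N) y)).
Qed.

Lemma first_marks_set_tnth F m N y t j :
  @first_marks F m N y \o set_tnth t j =
  mark_section F m (merge (numbers m N) t y) (@nth_point _ m N j).
Proof.
apply/funext => u; rewrite /first_marks /mark_section/=.
have [_ ->] := @nth_pointP _ m N j.
by rewrite set_mark_merge// uniq_numbers.
Qed.

Lemma prod_gamma_first_marks F g : upper_gamma_i Q mu muN gamma F g ->
  {ae Q, forall m, forall N, {ae muN, forall y,
    prod_gamma mu gamma (@first_marks F m N y)
      (fun t => \sum_j g (mark m (merge (numbers m N) t y)) (@nth_point _ m N j))}}.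
Proof.
apply: filterS => m gF N.
pose c := numbers m N.
have mgj y j : measurable_fun setT
    (fun t : (size c).-tuple Y => g (mark m (merge c t y)) (@nth_point _ m N j)).
  have [mx _] := @nth_pointP _ m N j; have [mg _] := gF _ mx.
  exact: (measurableT_comp mg (measurable_merge c y)).
have : {ae muN, forall y, forall j : 'I_(size c), {ae mpower mu (size c),
    forall t : (size c).-tuple Y, {ae mu, forall u,
    g (mark m (merge c (set_tnth t j u) y)) (@nth_point _ m N j) =
    gamma (mark_section F m (merge c t y) (@nth_point _ m N j))
      (mark_section F m (merge c t y) (@nth_point _ m N j)) u}}}.
  apply: ae_forall_count => j; have [mx xE] := @nth_pointP _ m N j.
  have [_ /(ae_merge muN_prod (erefl (size c)))] := gF _ mx.
  apply: filterS => y; apply: filterS => t; apply: filterS => u <-.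
  by rewrite xE set_mark_merge// uniq_numbers.
apply: filterS => y gy; split; first by apply: measurable_sum => j; exact: mgj.
exists (fun j t => g (mark m (merge c t y)) (@nth_point _ m N j)); split; last exact: aeW.
move=> j; split; first exact: mgj.
apply: filterS (gy j) => t; apply: filterS => u ->.
by rewrite first_marks_set_tnth.
Qed.

(** This bound by Gamma[F] provides the finite energy required by the domain of
    the product structure. *)
Lemma sum_nth_point_le (h : config (X * Y) -> R) g m y N : regular h g (mark m y) ->
  \sum_j g (mark m y) (@nth_point _ m N j) <= h (mark m y).
Proof.
move=> /regular_mark[g0 gh]; rewrite -lee_fin gh esum_points; last first.
  by move=> x mx; rewrite lee_fin g0.
rewrite (sum_nth_point m N (g (mark m y))) -sumEFin.
apply: (@nneseries_lim_ge _ (fun i => (g (mark m y) (point_of m i))%:E)).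
by move=> i _ /point_ofP[mi _]; rewrite lee_fin g0.
Qed.

(** The integrability of F^2 and of Gamma[F] under P passes to almost every m by
    [ae_average_lty], and then to almost every choice of the frozen marks by
    [ae_merge_lty]. *)
Lemma prod_dom_first_marks F : upper_dom Q mu muN P dom gamma F ->
  {ae Q, forall m, forall N, {ae muN, forall y,
    prod_dom mu dom gamma (@first_marks F m N y)}}.
Proof.
move=> domFull; have mF := upper_dom_measurable domFull.
have [LF domF [h [mh [g [gF hg]]] hoo]] := domFull.
have regm := ae_regular structure muN_prod domF gF hg.
have F2 : {ae Q, forall m, (\int[muN]_y (F (mark m y) ^+ 2)%:E < +oo)%E}.
  apply: (ae_average_lty P_law (F := fun w => F w ^+ 2)).
  - exact: measurable_funX.
  - by move=> w; exact: sqr_ge0.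
  - have /integrableP[_] := Lfun2_integrable_sqr LF.
    apply: le_lt_trans; apply: ge0_le_integral => //.
    + by move=> w _; rewrite lee_fin sqr_ge0.
    + by apply/measurable_EFinP; exact: measurable_funX.
    + apply: measurableT_comp => //; apply/measurable_EFinP.
      exact: measurable_funX.
    + by move=> w _ /=; rewrite lee_fin ler_norm.
have h0 : {ae P, forall w, 0 <= h w}.
  apply: (ae_marked P_law (A := [set w | 0 <= h w])).
    by rewrite -[[set _ | _]]setTI; exact: measurable_fun_le.
  apply: filterS regm => m; apply: filterS => y /regular_mark[g0 gh] /=.
  by rewrite -lee_fin gh esum_ge0// => x mx; rewrite lee_fin g0.
(* [ae_average_lty] asks for nonnegativity everywhere. *)
pose hp w := Num.max (h w) 0.
have mhp : measurable_fun setT hp by exact: measurable_maxr.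
have hp0 w : 0 <= hp w by rewrite /hp le_max lexx orbT.
have hpm : {ae Q, forall m, (\int[muN]_y (hp (mark m y))%:E < +oo)%E}.
  apply: (ae_average_lty P_law) => //.
  rewrite (ae_eq_integral (EFin \o h))//; try exact/measurable_EFinP.
  by apply: filterS h0 => w h0 _; rewrite /= /hp; congr EFin; apply/max_idPl.
have gm := prod_gamma_first_marks gF.
apply: filterS (filterI (filterI F2 hpm) (filterI regm (filterI domF gm))).
move=> m [[F2m hm] [regy [dm gmN]]] N.
pose c := numbers m N.
have mFm : measurable_fun setT (fun y => F (mark m y)).
  exact: (measurableT_comp mF (measurable_mark m)).
have mhpm : measurable_fun setT (fun y => hp (mark m y)).
  exact: (measurableT_comp mhp (measurable_mark m)).
have F2y := ae_merge_lty muN_prod (erefl (size c))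
  (f := fun y => (F (mark m y) ^+ 2)%:E)
  ((measurable_EFinP _ _).2 (measurable_funX 2 mFm)) (fun y => sqr_ge0 _) F2m.
have hy := ae_merge_lty muN_prod (erefl (size c))
  (f := fun y => (hp (mark m y))%:E)
  ((measurable_EFinP _ _).2 mhpm) (fun y => hp0 _) hm.
have regt := ae_merge muN_prod (erefl (size c)) regy.
have dt : {ae muN, forall y, forall j : 'I_(size c), {ae mpower mu (size c),
    forall t : (size c).-tuple Y, dom (@first_marks F m N y \o set_tnth t j)}}.
  apply: ae_forall_count => j; have [mx xE] := @nth_pointP _ m N j.
  have := ae_merge muN_prod (erefl (size c)) (dm _ mx).
  by apply: filterS => y; apply: filterS => t; rewrite first_marks_set_tnth.
apply: filterS (filterI (filterI F2y hy) (filterI regt (filterI dt (gmN N)))).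
move=> y [[F2t ht] [reg [domt gt]]]; split.
- by apply: Lfun2_sqr => //; exact: measurable_first_marks.
- exact: domt.
- exists (fun t => \sum_j g (mark m (merge c t y)) (@nth_point _ m N j)) => //.
  apply: le_lt_trans ht; apply: integral_le_ae.
  + by case: gt.
  + exact: (measurableT_comp mhpm (measurable_merge c y)).
  + by [].
  + apply: filterS reg => t /(sum_nth_point_le N) /le_trans; apply.
    by rewrite /hp le_max lexx.
Qed.

End descent.

(** * Energy image density of the upper structure *)

Section energy_image_density.
Context (R : realType) (dX dY : measure_display).
Context (X : measurableType dX) (Y : measurableType dY).
Variables (Q : probability (config X) R) (mu : probability Y R).
Variables (dom : set (Y -> R)) (gamma : (Y -> R) -> (Y -> R) -> Y -> R).
Hypothesis structure : local_dirichlet_structure mu dom gamma.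
Variables (muN : probability (markseq Y) R).
Hypothesis muN_prod : is_infinite_product mu muN.
Variables (P : probability (config (X * Y)) R).
Hypothesis P_law : is_marked_law Q muN P.

Section versions.
Variables (k : nat) (k0 : (0 < k)%N) (U : 'I_k -> config (X * Y) -> R).
Hypothesis domU : forall i, upper_dom Q mu muN P dom gamma (U i).
Variables (hp hm : 'I_k -> 'I_k -> config (X * Y) -> R).
Variables (gp gm : 'I_k -> 'I_k -> config (X * Y) -> X -> R).
Hypotheses (mhp : forall i j, measurable_fun setT (hp i j))
  (mhm : forall i j, measurable_fun setT (hm i j)).
Hypotheses
  (gpU : forall i j, upper_gamma_i Q mu muN gamma (U i \+ U j) (gp i j))
  (gmU : forall i j, upper_gamma_i Q mu muN gamma (U i \- U j) (gm i j)).
Hypotheses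
  (hpE : forall i j, {ae Q, forall m : config X, {ae muN, forall y : markseq Y,
    (hp i j (mark m y))%:E = \esum_(x in m) (gp i j (mark m y) x)%:E}})
  (hmE : forall i j, {ae Q, forall m : config X, {ae muN, forall y : markseq Y,
    (hm i j (mark m y))%:E = \esum_(x in m) (gm i j (mark m y) x)%:E}}).

Definition gamma_matrix (w : config (X * Y)) : 'M[R]_k :=
  \matrix_(i, j) ((hp i j w - hm i j w) / 4).

Definition point_matrix (w : config (X * Y)) (x : X) : 'M[R]_k :=
  \matrix_(i, j) ((gp i j w x - gm i j w x) / 4).

Definition partial_matrix (m : config X) N (w : config (X * Y)) : 'M[R]_k :=
  \sum_(0 <= i < N | is_number m i) point_matrix w (point_of m i).

Let ae_pair (A : 'I_k -> 'I_k -> config X -> Prop) :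
  (forall i j, {ae Q, forall m, A i j m}) ->
  {ae Q, forall m, forall i j, A i j m}.
Proof.
move=> Aae; have : {ae Q, forall m, forall p : 'I_k * 'I_k, A p.1 p.2 m}.
  by apply: ae_forall_count => p; exact: Aae.
by apply: filterS => m Am i j; exact: (Am (i, j)).
Qed.

Let ae_pair_marks (A : 'I_k -> 'I_k -> markseq Y -> Prop) :
  (forall i j, {ae muN, forall y, A i j y}) ->
  {ae muN, forall y, forall i j, A i j y}.
Proof.
move=> Aae; have : {ae muN, forall y, forall p : 'I_k * 'I_k, A p.1 p.2 y}.
  by apply: ae_forall_count => p; exact: Aae.
by apply: filterS => y Ay i j; exact: (Ay (i, j)).
Qed.

Lemma sections_U : {ae Q, forall m, forall x, points m x ->
  {ae muN, forall y, forall i, dom (mark_section (U i) m y x)}}.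
Proof.
have : {ae Q, forall m, forall i, forall x, points m x ->
    {ae muN, forall y, dom (mark_section (U i) m y x)}}.
  by apply: ae_forall_count => i; case: (domU i).
by apply: filterS => m dm x mx; apply: ae_forall_count => i; exact: dm.
Qed.

Lemma sections_add i j : sections_in_dom Q dom muN (U i \+ U j).
Proof.
apply: filterS sections_U => m dm x mx; apply: filterS (dm x mx) => y dy.
exact: (dom_add structure (dy i) (dy j)).
Qed.

Lemma sections_sub i j : sections_in_dom Q dom muN (U i \- U j).
Proof.
apply: filterS sections_U => m dm x mx; apply: filterS (dm x mx) => y dy.
exact: (dom_sub structure (dy i) (dy j)).
Qed.

Lemma measurable_point_matrix : {ae Q, forall m, forall x, points m x ->
  forall i j, measurable_fun setT (fun y => point_matrix (mark m y) x i j)}.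
Proof.
apply: filterS2 (ae_pair gpU) (ae_pair gmU) => m gpm gmm x mx i j.
have [mp _] := gpm i j x mx; have [mn _] := gmm i j x mx.
under eq_fun do rewrite mxE.
by apply: measurable_funM => //; exact: measurable_funB.
Qed.

(** Each of the countably many inequalities is measurable in the marks, hence
    follows by resampling the mark of [x] from [gamma_rat_psd] applied to the
    sections of U. *)
Lemma point_matrix_psd : {ae Q, forall m, {ae muN, forall y, forall x,
  points m x -> rat_psd (point_matrix (mark m y) x)}}.
Proof.
apply: filterS (filterI (filterI (ae_pair gpU) (ae_pair gmU))
  (filterI sections_U measurable_point_matrix)).
move=> m [[gpm gmm] [dm mM]]; apply: ae_forall_points => x mx.
apply: ae_forall_count => v.
apply: (@ae_of_resample _ _ _ mu muN muN_prod (numbering m x) [set y | 0 <=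
  \sum_i \sum_j ratr (v i) * point_matrix (mark m y) x i j * ratr (v j)]).
  rewrite -[[set _ | _]]setTI; apply: measurable_fun_le => //.
  apply: measurable_sum => i; apply: measurable_sum => j.
  by apply: measurable_funM => //; apply: measurable_funM => //; exact: mM.
have gpy : {ae muN, forall y, forall i j, {ae mu, forall u,
    gp i j (mark m (set_mark y (numbering m x) u)) x =
    gamma (mark_section (U i \+ U j) m y x) (mark_section (U i \+ U j) m y x) u}}.
  by apply: ae_pair_marks => i j; have [] := gpm i j x mx.
have gmy : {ae muN, forall y, forall i j, {ae mu, forall u,
    gm i j (mark m (set_mark y (numbering m x) u)) x =
    gamma (mark_section (U i \- U j) m y x) (mark_section (U i \- U j) m y x) u}}.
  by apply: ae_pair_marks => i j; have [] := gmm i j x mx.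
apply: filterS (filterI (filterI gpy gmy) (dm x mx)) => y [[gpu gmu] dy].
have gu : {ae mu, forall u, forall p : 'I_k * 'I_k,
    gp p.1 p.2 (mark m (set_mark y (numbering m x) u)) x =
    gamma (mark_section (U p.1) m y x \+ mark_section (U p.2) m y x)
      (mark_section (U p.1) m y x \+ mark_section (U p.2) m y x) u /\
    gm p.1 p.2 (mark m (set_mark y (numbering m x) u)) x =
    gamma (mark_section (U p.1) m y x \- mark_section (U p.2) m y x)
      (mark_section (U p.1) m y x \- mark_section (U p.2) m y x) u}.
  by apply: ae_forall_count => p; exact: filterI (gpu p.1 p.2) (gmu p.1 p.2).
apply: filterS2 gu (gamma_rat_psd structure k0 dy) => u gu /(_ v).
congr (_ <= _); apply: eq_bigr => i _; apply: eq_bigr => j _.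
by rewrite !mxE; have [-> ->] := gu (i, j).
Qed.

(** The terms gamma_i[U_i +- U_j] are nonnegative with a finite sum, so that their
    partial sums converge; the entries of Gamma are differences of two such
    sums. *)
Lemma cvg_partial_matrix : {ae Q, forall m, {ae muN, forall y, forall i j,
  partial_matrix m N (mark m y) i j @[N --> \oo] --> gamma_matrix (mark m y) i j}}.
Proof.
have cvg_part (h : config (X * Y) -> R) g m y : regular h g (mark m y) ->
    (\sum_(0 <= i < N | is_number m i) g (mark m y) (point_of m i))
      @[N --> \oo] --> h (mark m y).
  move=> /regular_mark[g0 gh].
  apply: (@fine_cvg _ nat \oo _ (fun N => (\sum_(0 <= i < N | is_number m i)
    g (mark m y) (point_of m i))%:E)).
  rewrite gh esum_points; last by move=> x mx; rewrite lee_fin g0.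
  under eq_fun do rewrite /= -sumEFin.
  apply: is_cvg_nneseries_cond => i _ /point_ofP[mi _]; rewrite lee_fin; exact: g0.
have regp := ae_pair (fun i j =>
  ae_regular structure muN_prod (@sections_add i j) (gpU i j) (hpE i j)).
have regm := ae_pair (fun i j =>
  ae_regular structure muN_prod (@sections_sub i j) (gmU i j) (hmE i j)).
apply: filterS2 regp regm => m /ae_pair_marks rp /ae_pair_marks rm.
apply: filterS2 rp rm => y rp rm i j.
rewrite mxE; under eq_fun do rewrite summxE.
under eq_fun do under eq_bigr do rewrite mxE.
under eq_fun do rewrite -mulr_suml sumrB.
by apply: cvgM; [apply: cvgB; exact: cvg_part|exact: cvg_cst].
Qed.

Hypothesis EID_n : forall n : nat, EID (mpower mu n)
  (@prod_dom _ Y R mu dom gamma n) (@prod_gamma _ Y R mu gamma n).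

Let Utuple (w : config (X * Y)) : k.-tuple (measurableTypeR R) :=
  [tuple U i w | i < k].

Let measurable_Utuple : measurable_fun setT Utuple.
Proof. by apply: measurable_mktuple => i; exact: upper_dom_measurable (domU i). Qed.

Variable B : set (k.-tuple (measurableTypeR R)).
Hypotheses (mB : measurable B) (B0 : mpower lebesgue_measure k B = 0%E).

(** With the other marks frozen, this is (EID) for the product structure on the
    marks of the first points.  It bounds an integral only: nonnegativity of the
    determinant turns this into a pointwise statement. *)
Lemma det_partial_matrix : {ae Q, forall m, forall N, {ae muN, forall y,
  B (Utuple (mark m y)) -> \det (partial_matrix m N (mark m y)) = 0}}.
Proof.
have Gp := ae_pair (fun i j => prod_gamma_first_marks muN_prod (gpU i j)).
have Gm := ae_pair (fun i j => prod_gamma_first_marks muN_prod (gmU i j)).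
have D : {ae Q, forall m, forall i, forall N, {ae muN, forall y,
    prod_dom mu dom gamma (@first_marks _ _ _ X Y (U i) m N y)}}.
  apply: ae_forall_count => i.
  exact: (prod_dom_first_marks structure muN_prod P_law (domU i)).
apply: filterS (filterI (filterI (filterI Gp Gm) D)
  (filterI measurable_point_matrix point_matrix_psd)).
move=> m [[[Gpm Gmm] Dm] [mM psdM]] N.
pose c := numbers m N; pose n := size c.
have mpart i j : measurable_fun setT (fun y => partial_matrix m N (mark m y) i j).
  rewrite /partial_matrix; under eq_fun do rewrite -sum_nth_point summxE.
  by apply: measurable_sum => l; have [mx _] := nth_pointP l; exact: mM.
have mdet : measurable_fun setT (fun y => \det (partial_matrix m N (mark m y))).
  exact: measurable_det.
have mUm : measurable_fun setT (fun y => Utuple (mark m y)).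
  exact: (measurableT_comp measurable_Utuple (measurable_mark m)).
apply: (@ae_of_merge _ _ _ mu muN muN_prod n c erefl [set y |
  B (Utuple (mark m y)) -> \det (partial_matrix m N (mark m y)) = 0]).
  apply: (@measurable_imply _ _ [set y | B (Utuple (mark m y))]
    [set y | \det (partial_matrix m N (mark m y)) = 0]).
    by have := mUm measurableT B mB; rewrite setTI.
  by have := mdet measurableT [set 0] (measurable_set1 0); rewrite setTI.
have Gpy := ae_pair_marks (fun i j => Gpm i j N).
have Gmy := ae_pair_marks (fun i j => Gmm i j N).
have Dy : {ae muN, forall y, forall i,
    prod_dom mu dom gamma (@first_marks _ _ _ X Y (U i) m N y)}.
  by apply: ae_forall_count => i; exact: Dm.
have psdy := ae_merge muN_prod (erefl n) psdM.
apply: filterS (filterI (filterI Gpy Gmy) (filterI Dy psdy)).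
move=> y [[Gpt Gmt] [Dt psdt]].
pose part t := partial_matrix m N (mark m (merge c t y)).
have pol i j : polarized (@prod_gamma _ Y R mu gamma n)
    (@first_marks _ _ _ X Y (U i) m N y) (@first_marks _ _ _ X Y (U j) m N y)
    (fun t : n.-tuple Y => part t i j).
  exists (fun t => \sum_l gp i j (mark m (merge c t y)) (@nth_point _ m N l)).
  exists (fun t => \sum_l gm i j (mark m (merge c t y)) (@nth_point _ m N l)).
  split; [exact: Gpt|exact: Gmt|move=> t].
  rewrite /part /partial_matrix -sum_nth_point summxE.
  under eq_bigr do rewrite mxE.
  by rewrite -mulr_suml sumrB.
have EIDB := EID_n k0 Dt pol.
pose Ut (t : n.-tuple Y) := Utuple (mark m (merge c t y)).
have {EIDB} : (\int[mpower mu n]_(t in Ut @^-1` B) (\det (part t))%:E = 0)%E.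
  have := EIDB B ((measure0_null_setP _ mB).2 B0) B mB (@subset_refl _ B).
  move=> <-; apply: eq_integral => t _; congr (\det _)%:E.
  by apply/matrixP => i j; rewrite mxE.
have mUt : measurable_fun setT Ut.
  exact: (measurableT_comp mUm (measurable_merge c y)).
move=> /integral0_ae; apply.
- by rewrite -[_ @^-1` _]setTI; exact: mUt.
- exact: (measurableT_comp mdet (measurable_merge c y)).
- apply: filterS psdt => t psdt; apply: det_psd_ge0; apply: rat_psd_sum.
  by move=> i /point_ofP[mi _]; exact: psdt.
Qed.

Lemma det_gamma_matrix :
  {ae P, forall w, B (Utuple w) -> \det (gamma_matrix w) = 0}.
Proof.
have mdet : measurable_fun setT (fun w => \det (gamma_matrix w)).
  apply: measurable_det => i j; under eq_fun do rewrite mxE.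
  by apply: measurable_funM => //; exact: measurable_funB.
apply: (ae_marked P_law (A := [set w | B (Utuple w) -> \det (gamma_matrix w) = 0])).
  apply: (@measurable_imply _ _ (Utuple @^-1` B)
    [set w | \det (gamma_matrix w) = 0]).
    by have := measurable_Utuple measurableT mB; rewrite setTI.
  have := mdet measurableT [set 0] (measurable_set1 0); by rewrite setTI.
apply: filterS2 det_partial_matrix cvg_partial_matrix => m detm cvgm.
have {}detm : {ae muN, forall y, forall N,
    B (Utuple (mark m y)) -> \det (partial_matrix m N (mark m y)) = 0}.
  exact: ae_foralln.
apply: filterS2 detm cvgm => y dety cvgy /= By.
have := cvg_det cvgy.
under eq_fun do rewrite dety//.
by move=> /(cvg_lim (@Rhausdorff R)) <-; exact: lim_cst.
Qed.

End versions.
End energy_image_density.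

Theorem theorem2 (R : realType)
    (dX dY : measure_display) (X : measurableType dX) (Y : measurableType dY)
    (singletonX : forall x : X, measurable [set x])
    (singletonY : forall y : Y, measurable [set y])
    (Q : probability (config X) R) (mu : probability Y R)
    (dom : set (Y -> R)) (gamma : (Y -> R) -> (Y -> R) -> Y -> R)
    (structure : local_dirichlet_structure mu dom gamma)
    (one_loc : local_domain dom (cst 1))
    (muN : probability (markseq Y) R) (muN_prod : is_infinite_product mu muN)
    (P : probability (config (X * Y)) R) (P_law : is_marked_law Q muN P) :
  (forall F, upper_dom Q mu muN P dom gamma F ->
    (exists H, gamma_epsp Q mu muN gamma F H) /\
    (forall Gamma_F H, upper_gamma Q mu muN gamma F Gamma_F ->
      gamma_epsp Q mu muN gamma F H ->
      {ae P, forall w, (Gamma_F w)%:E = integral_N (epsm H) w})) /\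
  ((forall n : nat,
      EID (mpower mu n) (@prod_dom _ Y R mu dom gamma n)
        (@prod_gamma _ Y R mu gamma n)) ->
    EID P (upper_dom Q mu muN P dom gamma) (upper_gamma Q mu muN gamma)).
Proof.
split.
  move=> F domFull; have [_ domF [h [mh [g [gF hg]]] _]] := domFull.
  split.
    exists (gamma_epsp_version h g).
    exact: (gamma_epsp_versionP structure muN_prod mh domF gF hg).
  move=> {h mh g gF hg} h H [mh [g [gF hg]]] HF.
  exact: (upper_gamma_epsp muN_prod P_law mh gF hg HF).
move=> EID_n k U G k0 domU polG N nullN B mB BN.
have B0 := nullN B mB BN.
have /choice[h hP] : forall p : 'I_k * 'I_k, exists q :
    (config (X * Y) -> R) * (config (X * Y) -> X -> R) *
    ((config (X * Y) -> R) * (config (X * Y) -> X -> R)),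
    [/\ measurable_fun setT q.1.1 /\ measurable_fun setT q.2.1,
      upper_gamma_i Q mu muN gamma (U p.1 \+ U p.2) q.1.2 /\
      upper_gamma_i Q mu muN gamma (U p.1 \- U p.2) q.2.2,
      {ae Q, forall m : config X, {ae muN, forall y : markseq Y,
        (q.1.1 (mark m y))%:E = \esum_(x in m) (q.1.2 (mark m y) x)%:E}},
      {ae Q, forall m : config X, {ae muN, forall y : markseq Y,
        (q.2.1 (mark m y))%:E = \esum_(x in m) (q.2.2 (mark m y) x)%:E}} &
      forall w, G p.1 p.2 w = (q.1.1 w - q.2.1 w) / 4].
  move=> [i j]; have [hp [hm [Gp Gm GE]]] := polG i j.
  have [mhp [gp [gpU hpE]]] := Gp; have [mhm [gm [gmU hmE]]] := Gm.
  by exists ((hp, gp), (hm, gm)).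
have mh1 i j : measurable_fun setT (h (i, j)).1.1 by have [[]] := hP (i, j).
have mh2 i j : measurable_fun setT (h (i, j)).2.1 by have [[]] := hP (i, j).
have det0 := @det_gamma_matrix R dX dY X Y Q mu dom gamma structure muN
  muN_prod P P_law k k0 U domU (fun i j => (h (i, j)).1.1) (fun i j => (h (i, j)).2.1)
  (fun i j => (h (i, j)).1.2) (fun i j => (h (i, j)).2.2) mh1 mh2
  (fun i j => let: And5 _ (conj gpU _) _ _ _ := hP (i, j) in gpU)
  (fun i j => let: And5 _ (conj _ gmU) _ _ _ := hP (i, j) in gmU)
  (fun i j => let: And5 _ _ hpE _ _ := hP (i, j) in hpE)
  (fun i j => let: And5 _ _ _ hmE _ := hP (i, j) in hmE) EID_n B mB B0.
have mG i j : measurable_fun setT (G i j).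
  rewrite (_ : G i j = fun w => ((h (i, j)).1.1 w - (h (i, j)).2.1 w) / 4).
    by apply: measurable_funM => //; exact: measurable_funB.
  by apply/funext => w; have [_ _ _ _ ->] := hP (i, j).
have mUB : measurable ((fun w => [tuple U i w | i < k] :
    k.-tuple (measurableTypeR R)) @^-1` B).
  have mU := measurable_mktuple (fun i => upper_dom_measurable (domU i)).
  by have := mU measurableT B mB; rewrite setTI.
rewrite /pushforward (ae_eq_integral (cst 0)) ?integral0//.
  apply/measurable_EFinP; apply: measurable_funTS; apply: measurable_det => i j.
  by under eq_fun do rewrite mxE; exact: mG.
apply: filterS det0 => w det0 wB.
transitivity (0%R%:E : \bar R) => //; rewrite -(det0 wB); congr (\det _)%:E.
by apply/matrixP => i j; rewrite !mxE; have [_ _ _ _ ->] := hP (i, j).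
Qed.
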